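(* Let $0<\alpha<\frac12$ be fixed. Let $Z_\alpha(ATSP)$ denote the minimum cost of a Traveling Salesperson Tour $T$ (directed Hamilton cycle) of the randomly weighted, randomly coloured complete digraph $\vec K_n$ with $|E_R\cap T|\le\alpha n$, and let $Z_\alpha(PM)$ denote the minimum cost of a perfect matching $M$ of the randomly weighted, randomly coloured complete bipartite graph $K_{n,n}$ with $|E_R\cap M|\le\alpha n$. Then w.h.p. $$Z_\alpha(ATSP)\sim Z_\alpha(PM).$$
   Context: Model: each edge $e$ of the complete digraph $\vec K_n$ on $\{1,\dots,n\}$ is given an independent cost $X_e$ with the exponential distribution of mean 1, and edges are then independently coloured red or blue with probability $1/2$ each; $E_R$ is the set of red edges. The cost of a tour $T$ is $C(T)=\sum_{e\in T}X_e$. The bipartite model $K_{n,n}$, with parts $\{a_1,\dots,a_n\}$ and $\{b_1,\dots,b_n\}$, likewise has independent mean-1 exponential costs and independent red/blue colours with probability $1/2$ each, and the cost of a matching is the sum of its edge costs. The two models are related by identifying the edge $\{a_i,b_j\}$ of $K_{n,n}$, with its cost and colour, with the directed edge $(i,j)$ for $i\ne j$; the edges $\{a_i,b_i\}$ correspond to loops, which also receive independent costs and colours. It is assumed that $\alpha n$ is an integer. Asymptotics are as $n\to\infty$ with $\alpha$ fixed. Events occur with high probability (w.h.p.) if their probability tends to $1$; ''$Z\sim Z'$ w.h.p.'' means that for every $\varepsilon>0$, $|Z-Z'|\le\varepsilon Z'$ w.h.p. *)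

(* Defs.v *)
From mathcomp Require Import all_boot all_order all_algebra.
From mathcomp Require Import all_classical all_reals all_analysis.

Set Implicit Arguments.
Unset Strict Implicit.
Unset Printing Implicit Defensive.

Import Order.TTheory GRing.Theory Num.Theory.
Import numFieldNormedType.Exports.

Local Open Scope ring_scope.

(* The pair (i, j) stands both for the directed edge i -> j (a loop if i = j)
   and for the edge {a_i, b_j} of K_{n,n}: this is the coupling of the two
   models. *)
Notation edge n := ('I_n * 'I_n)%type.

(* Directed Hamilton cycle of the complete (loopless) digraph on 'I_n, as a set
   of edges; c lists the vertices in cyclic order. *)
Definition is_tour (n : nat) (T : {set edge n}) : bool :=
  [forall e in T, e.1 != e.2] &&
  [exists c : n.-tuple 'I_n,
     uniq c && (T == [set (v, next c v) | v : 'I_n]%SET)].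

Definition is_perfect_matching (n : nat) (M : {set edge n}) : bool :=
  [forall i : 'I_n, #|[set e in M | e.1 == i]%SET| == 1%N] &&
  [forall j : 'I_n, #|[set e in M | e.2 == j]%SET| == 1%N].

Definition cost (R : realType) (n : nat) (x : edge n -> R)
    (S : {set edge n}) : R :=
  \sum_(e in S) x e.

(* The value is +oo when no admissible set has at most alpha * n red edges. *)
Definition min_cost (R : realType) (n : nat) (admissible : pred {set edge n})
    (alpha : R) (x : edge n -> R) (red : {set edge n}) : \bar R :=
  \big[Order.min/+oo%E]_(S : {set edge n} |
      admissible S && (#|red :&: S|%:R <= alpha * n%:R)) (cost x S)%:E.

Definition Z_ATSP (R : realType) (n : nat) (alpha : R) (x : edge n -> R)
    (red : {set edge n}) : \bar R :=
  min_cost (@is_tour n) alpha x red.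

Definition Z_PM (R : realType) (n : nat) (alpha : R) (x : edge n -> R)
    (red : {set edge n}) : \bar R :=
  min_cost (@is_perfect_matching n) alpha x red.

Local Open Scope classical_set_scope.

Definition mutually_independent (d : measure_display) (T : measurableType d)
    (R : realType) (P : probability T R) (I : finType)
    (F : I -> set (set T)) : Prop :=
  forall (J : {set I}) (E : I -> set T),
    (forall i, i \in J -> F i (E i)) ->
    P (\bigcap_(i in [set i | i \in J]) E i) = (\prod_(i in J) P (E i))%E.

Definition edge_sigma_algebra (d : measure_display) (T : measurableType d)
    (R : realType) (P : probability T R) (n : nat)
    (X : edge n -> {RV P >-> R}) (col : edge n -> {RV P >-> bool})
    (k : edge n + edge n) : set (set T) :=
  match k with
  | inl e => preimage_set_system setT (X e) measurable
  | inr e => preimage_set_system setT (col e) measurable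
  end.

(* The colour true is red. *)
Definition random_costs_colours (d : measure_display) (T : measurableType d)
    (R : realType) (P : probability T R) (n : nat)
    (X : edge n -> {RV P >-> R}) (col : edge n -> {RV P >-> bool}) : Prop :=
  [/\ forall e A, measurable A ->
        distribution P (X e) A = exponential_prob 1 A,
      forall e A, distribution P (col e) A = bernoulli_prob (2^-1) A
    & mutually_independent P (edge_sigma_algebra X col)].

Definition red_edges (T : Type) (n : nat) (col : edge n -> T -> bool)
    (w : T) : {set edge n} :=
  [set e | col e w]%SET.

(* n tends to infinity along D. *)
Definition whp (R : realType) (d : nat -> measure_display)
    (Omega : forall n, measurableType (d n))
    (P : forall n, probability (Omega n) R) (D : set nat)
    (E : forall n, set (Omega n)) : Prop :=
  P n (E n) @[n --> within D \oo] --> 1%E.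

(* An outcome at which one of the two quantities is infinite counts as a failure
   of the approximation. *)
Definition sim_whp (R : realType) (d : nat -> measure_display)
    (Omega : forall n, measurableType (d n))
    (P : forall n, probability (Omega n) R) (D : set nat)
    (Z Z' : forall n, Omega n -> \bar R) : Prop :=
  forall eps : R, 0 < eps ->
    whp P D (fun n => [set w |
      [/\ Z n w \is a fin_num, Z' n w \is a fin_num
        & (`|Z n w - Z' n w| <= eps%:E * Z' n w)%E]]).

(* Main.v *)
Require Import Defs.
From mathcomp Require Import all_boot all_order all_algebra all_fingroup.
From mathcomp Require Import all_classical all_reals all_analysis.
From mathcomp Require Import measurable_realfun.
From mathcomp Require Import zify ring lra.
Set Implicit Arguments.
Unset Strict Implicit.
Unset Printing Implicit Defensive.
Import Order.TTheory GRing.Theory Num.Theory.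
Import numFieldNormedType.Exports.

(** Why the theorem holds. Write a set of n edges with one edge in each row and
    column as the graph of a permutation t of the vertices, so that perfect
    matchings are permutations and tours are the permutations with one cycle.
    Every tour is a perfect matching, hence Z(PM) <= Z(ATSP). For the converse
    it is enough to turn an optimal matching, with high probability, into a tour
    by adding few edges, all blue and cheap: then the number of red edges does
    not grow, and the cost grows by little.

    Few cycles. The law of costs and colours does not change when the columns
    are permuted (configuration_law), and this composes the optimal permutation
    with an arbitrary one. So, on average over all relabellings, an optimal
    permutation t has as many cycles as a uniform one. By Burnside's lemma for
    the action on subsets the mean of 2 ^ (number of cycles) is at most n + 1
    (sum_pow2_porbits); hence 2 ^ (number of cycles) < (n + 1) ^ 2 outside an
    event of probability at most 1 / (n + 1) (prob_tangled), and the number of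
    cycles is of order log n.

    Cheap blue edges. Let theta = 1 / L ^ 3 where 2 ^ L <= n < 2 ^ L.+1, and let
    G consist of the blue edges of cost at most theta. A union bound over pairs
    of vertex sets shows that, with high probability, G has an edge between any
    two sets of s = n / L ^ 5 vertices and that its degrees are at least 7 * s
    (prob_not_joined). For such a graph, in any cyclic order of the vertices an
    edge (u, v) can be exchanged for edges of G by cutting the order into three
    or five segments and reordering these (tour_improve_last). G and t may
    depend on each other, because the property of G speaks of all vertex sets.
    Merging the cycles of t one after the other, and then exchanging the edges
    that are neither in t nor in G, gives a tour with at most 12 edges outside t
    for each cycle of t, all of them in G (tour_near_perm). Exchanging all edges
    outside G gives a tour inside G, so that both minima are finite
    (tour_inside).

    Comparison. Hence Z(ATSP) <= Z(PM) + O(L * theta) = Z(PM) + O(1 / L ^ 2).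
    On the other hand the expected number of edges of cost at most 1 / (L * n)
    is at most n / L, so with high probability half of the rows have no such edge
    and Z(PM) >= 1 / (2 * L) (prob_many_tiny, perm_cost_ge). Therefore the
    difference is of smaller order than Z(PM). All failure probabilities add up
    to at most 6 / L, which tends to 0. *)

(** * Exchanging segments of a cyclic sequence *)

Section PathWeight.
Variables (T : eqType) (f : T -> T -> nat).

Definition path_weight (x : T) (p : seq T) : nat := \sum_(a <- pairmap f x p) a.

(** The weight of the closed walk along c. Summing along the list, rather than
    over the vertices, makes it additive under concatenation. *)
Definition cycle_weight (c : seq T) : nat :=
  if c is x :: p then path_weight x (rcons p x) else 0.

Lemma path_weight_cat x p y q :
  path_weight x (p ++ y :: q) =
  path_weight x p + f (last x p) y + path_weight y q.
Proof. by rewrite /path_weight pairmap_cat big_cat /= big_cons addnA. Qed.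

Lemma cycle_weightE x p :
  cycle_weight (x :: p) = path_weight x p + f (last x p) x.
Proof.
have pw0 : path_weight x [::] = 0 by rewrite /path_weight big_nil.
by rewrite /= -cats1 path_weight_cat pw0 addn0.
Qed.

Lemma cycle_weight_next c : uniq c ->
  cycle_weight c = \sum_(v <- c) f v (next c v).
Proof.
case: c => [|x p] Uc; first by rewrite big_nil.
rewrite /cycle_weight /path_weight.
rewrite -(big_map (fun v => f v (next (x :: p) v)) xpredT id).
congr (\sum_(a <- _) a); apply: (@eq_from_nth _ 0).
  by rewrite size_pairmap size_map size_rcons.
move=> i; rewrite size_pairmap size_rcons => lti.
rewrite (nth_pairmap x) ?size_rcons // (nth_map x) //.
have -> : nth x (x :: rcons p x) i = nth x (x :: p) i.
  by rewrite -rcons_cons nth_rcons /= lti.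
rewrite next_nth mem_nth // index_uniq // nth_rcons.
case: (ltngtP i (size p)) => [//|ltpi|->]; last first.
  by rewrite [nth x p _]nth_default.
by exfalso; lia.
Qed.

Definition segment (c : seq T) a b := take (b - a) (drop a c).

Lemma segmentP x0 c a b : a < b <= size c ->
  exists2 s, segment c a b = nth x0 c a :: s
           & last (nth x0 c a) s = nth x0 c b.-1.
Proof.
move=> /andP[ltab leb]; rewrite /segment (drop_nth x0); last by lia.
have -> : b - a = (b - a).-1.+1 by lia.
exists (take (b - a).-1 (drop a.+1 c)) => //.
rewrite (last_nth x0) size_takel; last by rewrite size_drop; lia.
case E : (b - a).-1 => [|k] /=; first by congr nth; lia.
by rewrite nth_take // nth_drop; congr nth; lia.
Qed.

Lemma segment_cat c a b d : a <= b <= d -> d <= size c ->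
  segment c a b ++ segment c b d = segment c a d.
Proof.
move=> /andP[leab lebd] led; rewrite /segment.
have -> : d - a = (b - a) + (d - b) by lia.
rewrite takeD drop_drop; congr (_ ++ take _ (drop _ _)); lia.
Qed.

Lemma segment_full c : segment c 0 (size c) = c.
Proof. by rewrite /segment drop0 subn0 take_size. Qed.

(** The segments S1 S2 S3 of c are put into the order S1 S3 S2. Besides the
    edge that closes c two further edges disappear; their weights are dropped,
    whence the inequality. *)
Lemma rewire3 x0 c a b (n := size c) (w := nth x0 c) : 0 < a < b -> b < n ->
  exists2 c', perm_eq c' c &
  cycle_weight c' + f (w n.-1) (w 0) <=
  cycle_weight c + (f (w n.-1) (w a) + f (w b.-1) (w 0) + f (w a.-1) (w b)).
Proof.
move=> /andP[a0 ab] bn; set S1 := segment c 0 a; set S2 := segment c a b.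
set S3 := segment c b n.
have cE : c = S1 ++ S2 ++ S3.
  by rewrite catA !segment_cat ?segment_full //; lia.
exists (S1 ++ S3 ++ S2); first by rewrite {1}cE perm_cat2l perm_catC.
have [|s1 E1 L1] := @segmentP x0 c 0 a; first by lia.
have [|s2 E2 L2] := @segmentP x0 c a b; first by lia.
have [|s3 E3 L3] := @segmentP x0 c b n; first by lia.
rewrite (congr1 cycle_weight cE) /S1 /S2 /S3 E1 E2 E3 !cat_cons !cycle_weightE.
do 5!rewrite ?path_weight_cat ?last_cat /= ?L1 ?L2 ?L3 -?/(w _).
by lia.
Qed.

(** The segments S1, S2, S3, S4, S5 of c are put into the order S2 S1 S3 S5 S4,
    which has no junction in common with c. An entry into the closing vertex
    ends S2 and an exit from the last vertex starts S4, so this serves when the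
    entries come before the exits, the case that rewire3 does not cover. *)
Lemma rewire5 x0 c a b d e (n := size c) (w := nth x0 c) :
  0 < a < b -> b < d < e -> e < n ->
  exists2 c', perm_eq c' c &
  cycle_weight c' + f (w n.-1) (w 0) <=
  cycle_weight c + (f (w b.-1) (w 0) + f (w a.-1) (w b) + f (w d.-1) (w e) +
                    f (w n.-1) (w d) + f (w e.-1) (w a)).
Proof.
move=> /andP[a0 ab] /andP[bd de] en.
set S1 := segment c 0 a; set S2 := segment c a b.
set S3 := segment c b d; set S4 := segment c d e; set S5 := segment c e n.
have cE : c = S1 ++ S2 ++ S3 ++ S4 ++ S5.
  by rewrite /S4 /S5 !segment_cat ?segment_full //; lia.
exists (S2 ++ S1 ++ S3 ++ S5 ++ S4).
  rewrite {1}cE [X in perm_eq X _]catA [X in perm_eq _ X]catA.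
  by apply: perm_cat; rewrite ?perm_cat2l perm_catC.
have [|s1 E1 L1] := @segmentP x0 c 0 a; first by lia.
have [|s2 E2 L2] := @segmentP x0 c a b; first by lia.
have [|s3 E3 L3] := @segmentP x0 c b d; first by lia.
have [|s4 E4 L4] := @segmentP x0 c d e; first by lia.
have [|s5 E5 L5] := @segmentP x0 c e n; first by lia.
rewrite (congr1 cycle_weight cE) /S1 /S2 /S3 /S4 /S5 E1 E2 E3 E4 E5.
rewrite !cat_cons !cycle_weightE.
do 5!rewrite ?path_weight_cat ?last_cat /= ?L1 ?L2 ?L3 ?L4 ?L5 -!/(w _).
by lia.
Qed.

End PathWeight.

(** * Permutations, their cycles and cyclic orders *)

Section Cycles.
Variable T : finType.
Implicit Types t u : {perm T}.

(** Multiplying by a transposition of points of two cycles merges these cycles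
    and changes two values; repeat until at most one cycle is left. *)
Lemma merge_cycles t (x0 : T) : exists u,
  #|porbits u| <= 1 /\ #|[set x | u x != t x]|.+2 <= 2 * #|porbits t|.
Proof.
have [k] := ubnP #|porbits t|; elim: k t => // k IH t ltk.
have pos : 0 < #|porbits t|.
  by apply/card_gt0P; exists (porbit t x0); apply: imset_f.
have [le1|] := leqP #|porbits t| 1.
  exists t; split=> //.
  rewrite (_ : [set x | t x != t x] = finset.set0) ?cards0; first by lia.
  by apply/setP => x; rewrite !inE eqxx.
move=> /card_gt1P[_ [_ [/imsetP[x _ ->] /imsetP[y _ ->] neq]]].
have xy : x \notin porbit t y by apply: contra neq; rewrite eq_porbit_mem.
have nxy : x != y by apply: contraNneq xy => ->; apply: porbit_id.
have := porbits_mul_tperm t x y; rewrite /= xy nxy /= => E.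
have {}E : #|porbits (tperm x y * t)| + 1 = #|porbits t|.
  by move: E; rewrite -addnn addnA => /addIn.
have [|u [u1 cu]] := IH (tperm x y * t)%g; first by move: ltk; rewrite -E addn1.
exists u; split=> //.
suff : #|[set z | u z != t z]| <= #|[set z | u z != (tperm x y * t)%g z]| + 2.
  move=> le; rewrite -E mulnDr muln1 -addn2.
  rewrite -(leq_add2r 2) in le; apply: (leq_trans le).
  by rewrite leq_add2r addn2.
have <- : #|[set x; y]| = 2 by rewrite cards2 nxy.
apply: leq_trans (leq_card_setU _ _); apply/subset_leq_card/fintype.subsetP => z.
rewrite !inE permM; case: tpermP => [->|->|_ _ ->] //; by rewrite eqxx /= ?orbT.
Qed.

(** The orbit of any point lists all points. *)
Lemma cyclic_tour u (x0 : T) : #|porbits u| <= 1 ->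
  exists c, [/\ uniq c, forall x, x \in c & forall x, next c x = u x].
Proof.
move=> u1; have Ac x : x \in fingraph.orbit u x0.
  have : porbit u x = porbit u x0.
    by move/card_le1_eqP: u1; apply; apply: imset_f.
  move/eqP; rewrite eq_porbit_mem => /porbitP[i ->].
  by rewrite permX -fconnect_orbit fconnect_iter.
exists (fingraph.orbit u x0); split=> //.
by move=> x; apply/nextE => //; apply: cycle_orbit; apply: perm_inj.
Qed.

(** The unions of cycles of t are stable under t, and distinct sets of cycles
    have distinct unions. *)
Lemma pow2_porbits_le_stable t :
  2 ^ #|porbits t| <= #|[set A : {set T} | t @: A == A]|.
Proof.
rewrite -card_powerset; pose F (C : {set {set T}}) := [set x | porbit t x \in C].
rewrite -(@card_in_imset _ _ F) => [|C D]; last first.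
  rewrite !inE => sC sD /setP FE; apply/setP => A.
  have [/imsetP[x _ ->]|nA] := boolP (A \in porbits t).
    by have := FE x; rewrite !inE.
  have notin (E : {set {set T}}) : E \subset porbits t -> (A \in E) = false.
    by move=> sE; apply: contraNF nA => AE; exact: (fintype.subsetP sE _ AE).
  by rewrite !notin.
apply/subset_leq_card/fintype.subsetP => _ /imsetP[C _ ->]; rewrite inE eqEcard.
rewrite card_imset ?leqnn ?andbT; last exact: perm_inj.
apply/fintype.subsetP => _ /imsetP[x + ->]; rewrite !inE.
suff -> : porbit t (t x) = porbit t x by [].
by have := porbit_perm t 1 x; rewrite expg1.
Qed.

Lemma perm_of_card_eq (A B : {set T}) : #|A| = #|B| ->
  exists t : {perm T}, t @: A = B.
Proof.
move=> cAB; pose listing (C : {set T}) := enum C ++ enum (~: C).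
have Ul C : uniq (listing C).
  rewrite cat_uniq !enum_uniq andbT; apply/hasPn => x.
  by rewrite !mem_enum inE.
have Al C x : x \in listing C by rewrite mem_cat !mem_enum inE orbN.
have szl C : size (listing C) = #|T| by rewrite size_cat -!cardE cardsC.
pose f x := nth x (listing B) (index x (listing A)).
have lt x : index x (listing A) < size (listing B).
  by rewrite szl -(szl A) index_mem.
have f_inj : injective f.
  move=> x y; rewrite /f (set_nth_default x y) // => /eqP.
  by rewrite nth_uniq // => /eqP /(congr1 (nth x (listing A))); rewrite !nth_index.
exists (perm f_inj); apply/eqP.
rewrite eqEcard card_imset ?cAB ?leqnn ?andbT; last exact: perm_inj.
apply/fintype.subsetP => _ /imsetP[x xA ->]; rewrite permE /f.
have ltB : index x (listing A) < size (enum B).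
  by rewrite -cardE -cAB cardE index_cat mem_enum xA index_mem mem_enum.
by rewrite nth_cat ltB -mem_enum mem_nth.
Qed.

(** Burnside's lemma for the action of the symmetric group on subsets: the
    orbits are indexed by the cardinality, so there are at most #|T|.+1 of
    them. *)
Lemma sum_pow2_porbits :
  \sum_(t : {perm T}) 2 ^ #|porbits t| <= #|T|.+1 * (#|T|)`!.
Proof.
apply: leq_trans (_ : \sum_(t in [set: {perm T}])
                       #|'Fix_([set: {set T}] | 'P^*)[t]| <= _)%g.
  rewrite [leqRHS](eq_bigl xpredT) => [|t]; last by rewrite inE.
  apply: leq_sum => t _; apply: leq_trans (pow2_porbits_le_stable t) _.
  apply/subset_leq_card/fintype.subsetP => A; rewrite !inE /= => /eqP tA.
  by rewrite finset.sub1set inE; apply/eqP.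
rewrite Frobenius_Cauchy; last first.
  by apply/fintype.subsetP => t _; rewrite !inE; apply/fintype.subsetP => A; rewrite !inE.
have -> : #|[set: {perm T}]| = (#|T|)`!.
  rewrite -cardsT -card_perm; apply: eq_card => t; rewrite [LHS]inE.
  by apply/esym/fintype.subsetP => x _; rewrite inE.
rewrite leq_mul2r; apply/orP; right.
pose initial k : {set T} := [set x in take k (enum T)].
pose F (k : 'I_#|T|.+1) := orbit ('P^*) [set: {perm T}] (initial k).
rewrite -[leqRHS]card_ord; apply: leq_trans (leq_imset_card F _).
apply/subset_leq_card/fintype.subsetP => _ /imsetP[A _ ->]; apply/imsetP.
have ltA : #|A| < #|T|.+1 by rewrite ltnS max_card.
exists (Ordinal ltA) => //; apply/eqP; rewrite /F /= orbit_eq_mem.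
have [|t tE] := @perm_of_card_eq (initial #|A|) A.
  rewrite cardsE (card_uniqP _) ?take_uniq ?enum_uniq // size_takel //.
  by rewrite -cardE max_card.
by apply/orbitP; exists t; rewrite // inE.
Qed.

End Cycles.

(** Markov's inequality for the mean of 2 ^ (number of cycles). *)
Lemma card_many_cycles (T : finType) :
  #|[set t : {perm T} | #|T|.+1 ^ 2 <= 2 ^ #|porbits t|]| * #|T|.+1 <= (#|T|)`!.
Proof.
rewrite -(leq_pmul2r (ltn0Sn #|T|)) -mulnA mulnn [leqRHS]mulnC.
apply: leq_trans (sum_pow2_porbits T); rewrite -sum_nat_const.
rewrite big_mkcond; apply: leq_sum => t _; rewrite inE.
by case: ifP.
Qed.

(** * Tours supported by an expanding graph *)

(** All pairs of sets are covered, so that the sets may depend on G itself. *)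
Definition joined (T : finType) (G : rel T) (a b : nat) :=
  forall S U : {set T}, a <= #|S| -> b <= #|U| ->
  exists x y, [/\ x \in S, y \in U & G x y].

Lemma joined_imset (T T' T'' : finType) (G : rel T) a b (f : T' -> T)
    (g : T'' -> T) (S : {set T'}) (U : {set T''}) : joined G a b ->
  {in S &, injective f} -> {in U &, injective g} -> a <= #|S| -> b <= #|U| ->
  exists x y, [/\ x \in S, y \in U & G (f x) (g y)].
Proof.
move=> J If Ig aS bU; have [|| _ [_ [/imsetP[x xS ->] /imsetP[y yU ->] Gxy]]] :=
  J (f @: S) (g @: U); rewrite ?card_in_imset //.
by exists x, y.
Qed.

(** Fewer than s elements of S can lack an edge to U, since these elements and
    U would contradict joined. *)
Lemma joined_many (T T' T'' : finType) (G : rel T) s (f : T' -> T)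
    (g : T'' -> T) (S : {set T'}) (U : {set T''}) : 0 < s -> joined G s s ->
  {in S &, injective f} -> {in U &, injective g} -> s.*2 <= #|S| -> s <= #|U| ->
  s <= #|[set x in S | [exists y in U, G (f x) (g y)]]|.
Proof.
move=> s0 J If Ig sS sU; rewrite leqNgt; apply/negP => small.
set S1 := [set x in S | _] in small.
have S1S : S1 \subset S by apply/fintype.subsetP => x; rewrite inE => /andP[].
have [||||x [y [/setDP[xS]]]] := @joined_imset _ _ _ G s s f g (S :\: S1) U J.
- by apply: sub_in2 If => x /setDP[].
- by [].
- by rewrite cardsDS //; lia.
- by [].
by rewrite inE xS /= => /negP + yU Gxy; apply; apply/existsP; exists y; rewrite yU.
Qed.

Section Positions.
Variables (T : finType) (pos : T -> nat).
Hypothesis pos_inj : injective pos.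

(** Raising r by one adds at most one element, because positions are distinct;
    so every intermediate cardinality occurs. *)
Lemma split_at_card (A : {set T}) k : k <= #|A| ->
  exists r, #|[set x in A | pos x < r]| = k.
Proof.
move=> kA; pose N r := #|[set x in A | pos x < r]|.
have [M AM] : exists M, k <= N M.
  exists (\max_(x in A) pos x).+1; suff -> : N (\max_(x in A) pos x).+1 = #|A| by [].
  apply: eq_card => x; rewrite inE; case: (boolP (x \in A)) => //= xA.
  by rewrite ltnS (bigD1 x) //= leq_maxl.
have ex : exists M, k <= N M by exists M.
case: (ex_minnP ex) => r kr minr; exists r; apply/eqP; rewrite eqn_leq kr andbT.
case: r kr minr => [|r] kr minr.
  apply: leq_trans (leq0n k); rewrite leqn0 cards_eq0; apply/eqP/setP=> x.
  by rewrite !inE ltn0 andbF.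
have lt : N r < k by rewrite ltnNge; apply/negP => /minr; rewrite ltnn.
apply: (leq_trans _ lt).
have [/existsP[z /andP[zA /eqP zr]]|no] := boolP [exists z in A, pos z == r].
  apply: leq_trans (_ : #|z |: [set x in A | pos x < r]| <= _).
    apply/subset_leq_card/fintype.subsetP => x; rewrite !inE => /andP[xA].
    rewrite ltnS leq_eqVlt -zr => /orP[/eqP/pos_inj->|xr]; first by rewrite eqxx.
    by rewrite xA xr orbT.
  by rewrite cardsU1 -/(N r); case: (_ \notin _) => /=; lia.
apply: leqW; apply/subset_leq_card/fintype.subsetP => x; rewrite !inE => /andP[xA].
rewrite ltnS leq_eqVlt xA => /orP[xr|//].
by move: no => /existsPn/(_ x); rewrite xA xr.
Qed.

Lemma card_pos_neq (A : {set T}) k : #|A|.-1 <= #|[set x in A | pos x != k]|.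
Proof.
have [/existsP[z /andP[zA /eqP zk]]|no] := boolP [exists z in A, pos z == k].
  rewrite (cardsD1 z A) zA /=; apply/subset_leq_card/fintype.subsetP => x.
  rewrite !inE -zk => /andP[nx ->] /=; apply: contra nx => /eqP/pos_inj -> //.
apply: leq_trans (leq_pred _) _; apply/subset_leq_card/fintype.subsetP => x xA.
by rewrite inE xA; move: no => /existsPn/(_ x); rewrite xA.
Qed.

Lemma card_split (A : {set T}) r :
  #|A| = #|[set x in A | pos x < r]| + #|[set x in A | r <= pos x]|.
Proof.
rewrite -(cardsID [set x | pos x < r] A); congr addn; apply: eq_card => x.
  by rewrite !inE.
by rewrite !inE -leqNgt andbC.
Qed.

End Positions.

(** The factor 7 leaves room for the blocks of s and 2 * s neighbours, and the
    few excluded positions, that tour_improve_last takes out of a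
    neighbourhood. *)
Definition expanding (T : finType) (G : rel T) (s : nat) : Prop :=
  [/\ 0 < s, joined G s s, forall u, 7 * s <= #|[set y | G u y]|
    & forall v, 7 * s <= #|[set x | G x v]|].

Section ExpandingGraph.
Variables (T : finType) (G : rel T) (s : nat).
Hypothesis G_expanding : expanding G s.

Section Improvement.
Variable h : T -> T -> nat.
Hypothesis h_le1 : forall x y, G x y -> h x y <= 1.

(** An edge of weight at least 6 from the last vertex u of c to its first
    vertex v can be traded for three or five edges of G, of weight at most one
    each. An exchange needs an out-neighbour y of u at which a segment starts
    and an in-neighbour x of v at which a segment ends; whether y can be taken
    before x decides which exchange is used, and the remaining new edges come
    from joined. *)
Lemma tour_improve_last x0 c (w := nth x0 c) : uniq c -> (forall x, x \in c) ->
  6 <= h (w (size c).-1) (w 0) ->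
  exists2 c', perm_eq c' c & cycle_weight h c' < cycle_weight h c.
Proof.
have [s_gt0 Gjoined outdeg indeg] := G_expanding.
move=> Uc Ac bad; set n := size c; pose pos x := index x c.
have posK x : w (pos x) = x by apply: nth_index.
have pos_inj : injective pos by move=> x y /(congr1 w); rewrite !posK.
have posn x : pos x < n by rewrite index_mem.
have w_inj i j : i < n -> j < n -> w i = w j -> i = j.
  by move=> li lj /eqP; rewrite nth_uniq // => /eqP.
set u := w n.-1; set v := w 0.
have succ_inj (S : {set T}) : (forall x, x \in S -> (pos x).+1 < n) ->
    {in S &, injective (fun x => w (pos x).+1)}.
  by move=> P x y /P lx /P ly /w_inj E; apply: pos_inj; apply/succn_inj/E.
have pred_inj (S : {set T}) : (forall x, x \in S -> 0 < pos x) ->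
    {in S &, injective (fun x => w (pos x).-1)}.
  move=> P x y /P lx /P ly /w_inj E; apply: pos_inj.
  by have := E ltac:(have := posn x; lia) ltac:(have := posn y; lia); lia.
have [|r cYr] := @split_at_card _ pos pos_inj [set y | G u y] (3 * s).
  by apply: leq_trans (outdeg u); lia.
have := card_split pos [set y | G u y] r; rewrite cYr => cY.
have := outdeg u; rewrite {}cY => cY.
have [big|small] := leqP (s.+1) #|[set x in [set x | G x v] | r <= pos x]|.
  (* Many out-neighbours y of u precede many in-neighbours x of v: exchange the
     segment from y to x with the one that follows it. *)
  have [||||y [x [/setIdP[/setIdP[yA yr] y0] /setIdP[/setIdP[xA xr] xn] Gyx]]]
    := @joined_imset T T T G s s (fun x => w (pos x).-1)
    (fun x => w (pos x).+1)
    [set y in [set y in [set y | G u y] | pos y < r] | pos y != 0]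
    [set x in [set x in [set x | G x v] | r <= pos x] | pos x != n.-1] Gjoined.
  - by apply: pred_inj => x; rewrite inE lt0n => /andP[].
  - by apply: succ_inj => x; rewrite inE => /andP[_]; have := posn x; lia.
  - by apply: leq_trans (card_pos_neq pos_inj _ _); rewrite cYr; lia.
  - by apply: leq_trans (card_pos_neq pos_inj _ _); lia.
  rewrite inE in yA; rewrite inE in xA.
  have [||c' pc p] := @rewire3 _ h x0 c (pos y) (pos x).+1.
  - by lia.
  - by have := posn x; rewrite -/n; lia.
  exists c' => //; move: p => /=; rewrite -/w -/n -/u -/v !posK.
  have := h_le1 yA; have := h_le1 xA; have := h_le1 Gyx.
  by move: bad; rewrite -/u -/v; lia.
(* Otherwise most in-neighbours of v come before position r, hence before most
   out-neighbours of u. The positions are cut so that at least 2 * s vertices z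
   precede the set X' of in-neighbours x, then comes the set Y' of
   out-neighbours y, and at least 2 * s vertices t follow Y'. *)
have := card_split pos [set x | G x v] r; have := indeg v => cX cX'; move: cX.
rewrite {}cX' => cX.
have [|r1] := @split_at_card _ pos pos_inj
  [set x in [set x | G x v] | pos x < r] (2 * s).
  by lia.
set X1 := [set x in _ | _ < r] => cX1; rewrite -/X1 in cX.
have := card_split pos X1 r1; rewrite cX1 => cX2.
set X2 := [set x in X1 | r1 <= pos x] in cX2.
have [|r2] := @split_at_card _ pos pos_inj
  [set x in [set x | G u x] | r <= pos x] s.
  by lia.
set Y1 := [set x in _ | r <= _] => cY1; rewrite -/Y1 in cY.
have := card_split pos Y1 r2; rewrite cY1 => cY2.
set Y2 := [set x in Y1 | r2 <= pos x] in cY2.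
set Y' := [set x in Y1 | pos x < r2] in cY1.
pose X' := [set x in X2 | pos x != r.-1].
pose Z0 := [set z | pos z < r1].
pose T0 := [set t in [set t | r2 <= pos t] | pos t != n.-1].
(* Leaving out position r.-1 makes the segment between x and y non-empty, and
   leaving out n.-1 does so for the segment after t. *)
have cX' : s <= #|X'| by apply: leq_trans (card_pos_neq pos_inj _ _); lia.
have cZ0 : 2 * s <= #|Z0|.
  rewrite -cX1; apply/subset_leq_card/fintype.subsetP => x.
  by rewrite !inE => /andP[].
have cT0 : 2 * s <= #|T0|.
  apply: leq_trans (card_pos_neq pos_inj _ _).
  suff : #|Y2| <= #|[set t | r2 <= pos t]| by lia.
  by apply/subset_leq_card/fintype.subsetP => x; rewrite !inE => /andP[].
have X'P x : x \in X' -> [/\ G x v, r1 <= pos x & (pos x).+1 < r].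
  by rewrite !inE -!andbA => /and4P[-> xr -> xr1]; split=> //; lia.
have Y'P y : y \in Y' -> [/\ G u y, r <= pos y & pos y < r2].
  by rewrite !inE -!andbA => /and3P[-> -> ->].
have rn : r < n.
  have /card_gt0P[y /Y'P[_ + _]] : 0 < #|Y'| by rewrite cY1.
  by move/leq_ltn_trans; apply; apply: posn.
have succT : {in T0 &, injective (fun t => w (pos t).+1)}.
  by apply: succ_inj => t; rewrite inE => /andP[_]; have := posn t; lia.
(* Most z have an edge to the successor of some x, and the successors of most t
   receive an edge from the predecessor of some y; so some such t has an edge to
   the successor of some such z. *)
have GoodZ : s <= #|[set z in Z0 | [exists x in X', G z (w (pos x).+1)]]|.
  apply: (@joined_many T T T G s id (fun x => w (pos x).+1)) => //; last by lia.
  by apply: succ_inj => x /X'P[]; lia.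
have GoodT : s <=
    #|[set t in T0 | [exists y in Y', G (w (pos y).-1) (w (pos t).+1)]]|.
  apply: (@joined_many T T T (fun x y => G y x) s (fun t => w (pos t).+1)
    (fun y => w (pos y).-1)) => //; [| |by lia|by rewrite cY1].
    by move=> S U sS sU; have [x [y [xU yS Gxy]]] := Gjoined _ _ sU sS; exists y, x.
  apply: pred_inj => y /Y'P[_ ry _]; apply: leq_trans ry.
  by have /card_gt0P[x /X'P[]] := leq_trans s_gt0 cX'; lia.
have [||t [z [/setIdP[tT /existsP[y /andP[yY Gyt]]]
                /setIdP[zZ /existsP[x /andP[xX Gzx]]] Gtz]]] :=
  @joined_imset T T T G s s id (fun z => w (pos z).+1) _ _ Gjoined _ _
    GoodT GoodZ.
- by [].
- apply: succ_inj => z /setIdP[+ _]; rewrite inE => zr.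
  by have /card_gt0P[x /X'P[]] := leq_trans s_gt0 cX'; lia.
have [Gxv rx xr] := X'P _ xX; have [Guy ry yr] := Y'P _ yY.
rewrite inE in zZ; move: tT; rewrite !inE => /andP[tr tn].
have tn' := posn t.
have [|||c' pc p] := @rewire5 _ h x0 c (pos z).+1 (pos x).+1 (pos y) (pos t).+1.
- by lia.
- by rewrite -/n; lia.
- by rewrite -/n; lia.
exists c' => //; move: p => /=; rewrite -/w -/n -/u -/v !posK.
have := h_le1 Gxv; have := h_le1 Guy; have := h_le1 Gyt; have := h_le1 Gzx.
by have := h_le1 Gtz; move: bad; rewrite -/u -/v; lia.
Qed.

(** Rotating c brings any edge to the closing position. *)
Lemma tour_improve c v : uniq c -> (forall x, x \in c) -> 6 <= h v (next c v) ->
  exists2 c', perm_eq c' c & cycle_weight h c' < cycle_weight h c.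
Proof.
move=> Uc Ac bad; have [i p rE] := rot_to (Ac (next c v)).
have Ur : uniq (rot i c) by rewrite rot_uniq.
have rotW : cycle_weight h (rot i c) = cycle_weight h c.
  rewrite !cycle_weight_next // (perm_big c) ?perm_rot //=.
  by apply: eq_bigr => x _; rewrite next_rot.
have Ar x : x \in rot i c by rewrite mem_rot.
have lastE : nth v (rot i c) (size (rot i c)).-1 = v.
  rewrite -[RHS](prev_next Uc) -(prev_rot i Uc) prev_nth Ar rE /=.
  rewrite memNindex; last by move: Ur; rewrite rE /= => /andP[].
  by rewrite (set_nth_default v).
have [|c' pc lt] := tour_improve_last (x0 := v) Ur Ar.
  by rewrite lastE rE.
by exists c'; [apply: perm_trans pc _; rewrite perm_rot | rewrite -rotW].
Qed.

(** Every improvement lowers a natural number, so the process stops, and it can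
    only stop at a tour without heavy edges. *)
Lemma light_tour c0 : uniq c0 -> (forall x, x \in c0) ->
  exists c, [/\ uniq c, forall x, x \in c, forall v, h v (next c v) < 6 &
     cycle_weight h c <= cycle_weight h c0].
Proof.
have [k] := ubnP (cycle_weight h c0); elim: k c0 => // k IH c0 ltk Uc0 Ac0.
have [/existsP[v bad]|no] := boolP [exists v, 6 <= h v (next c0 v)].
  have [c1 pc lt] := tour_improve Uc0 Ac0 bad.
  have [|x|c [Uc Ac light le]] := IH c1 (leq_trans lt ltk).
  - by rewrite (perm_uniq pc).
  - by rewrite (perm_mem pc).
  by exists c; split=> //; apply: leq_trans le (ltnW lt).
exists c0; split=> // v; rewrite ltnNge; exact: (existsPn no).
Qed.

End Improvement.

(** Give weight 0 to the edges of t, weight 1 to the other edges of G and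
    weight 6 to the rest. Merging the cycles of t costs at most two edges of
    weight 6 for each cycle; a light tour of no larger weight has only edges of
    t and of G, and its weight is the number of edges outside t. *)
Lemma tour_near_perm (x0 : T) (t : {perm T}) : exists c,
  [/\ uniq c, forall x, x \in c, forall v, (next c v == t v) || G v (next c v)
    & #|[set v | next c v != t v]| <= 12 * #|porbits t|].
Proof.
pose h x y := if y == t x then 0 else if G x y then 1 else 6.
have sumE c (F : T -> nat) : uniq c -> (forall x, x \in c) ->
    \sum_(v <- c) F v = \sum_v F v.
  move=> Uc Ac; rewrite big_uniq //=; apply: eq_bigl => x.
  by rewrite Ac.
have [u [u1 cu]] := merge_cycles t x0.
have [c0 [Uc0 Ac0 nc0]] := cyclic_tour x0 u1.
have h_le1 x y : G x y -> h x y <= 1 by rewrite /h => ->; case: ifP.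
have [c [Uc Ac light le]] := light_tour h_le1 Uc0 Ac0.
exists c; split=> // [v|].
  by have := light v; rewrite /h; case: ifP => //; case: ifP.
rewrite (cycle_weight_next _ Uc) (cycle_weight_next _ Uc0) in le.
rewrite (sumE c _ Uc Ac) (sumE c0 _ Uc0 Ac0) in le.
apply: leq_trans (_ : _ <= 6 * #|[set x | u x != t x]|) _; last by lia.
rewrite -!sum1_card big_distrr /= big_mkcond [leqRHS]big_mkcond /=.
apply: leq_trans (leq_trans le _); apply: leq_sum => v _; rewrite inE /h ?nc0.
  by case: (next c v == _) => //=; case: ifP.
by case: (u v == _) => //=; case: ifP.
Qed.

(** As in tour_near_perm, with weight 1 on G and 6 elsewhere. *)
Lemma tour_inside (x0 : T) : exists c,
  [/\ uniq c, forall x, x \in c & forall v, G v (next c v)].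
Proof.
pose h x y := if G x y then 1 else 6.
have [u [u1 _]] := merge_cycles 1 x0.
have [c0 [Uc0 Ac0 nc0]] := cyclic_tour x0 u1.
have h_le1 x y : G x y -> h x y <= 1 by rewrite /h => ->.
have [c [Uc Ac light _]] := light_tour h_le1 Uc0 Ac0.
by exists c; split=> // v; have := light v; rewrite /h; case: ifP.
Qed.

End ExpandingGraph.

Local Open Scope classical_set_scope.
Local Open Scope ring_scope.

(** * Finite families of events *)

Section FiniteMeasurability.
Context d (T : measurableType d).

Lemma measurable_exists (I : finType) (Q : I -> T -> Prop) :
  (forall i, measurable [set w | Q i w]) -> measurable [set w | exists i, Q i w].
Proof.
move=> mQ; rewrite (_ : mkset _ = \bigcup_(i in [set: I]) [set w | Q i w]).
  by apply: fin_bigcup_measurable => //; exact: finite_finset.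
by apply/seteqP; split => [w [i Qi]|w [i _ Qi]]; exists i.
Qed.

Lemma measurable_forall (I : finType) (Q : I -> T -> Prop) :
  (forall i, measurable [set w | Q i w]) -> measurable [set w | forall i, Q i w].
Proof.
move=> mQ; rewrite (_ : mkset _ = \bigcap_(i in [set: I]) [set w | Q i w]).
  by apply: fin_bigcap_measurable => //; exact: finite_finset.
by apply/seteqP; split => [w Qw i _|w Qw i]; apply: Qw.
Qed.

Lemma measurable_imply (A B : T -> Prop) :
  measurable [set w | A w] -> measurable [set w | B w] ->
  measurable [set w | A w -> B w].
Proof.
move=> mA mB; rewrite (_ : mkset _ = ~` [set w | A w] `|` [set w | B w]).
  by apply: measurableU => //; apply: measurableC.
apply/seteqP; split => [w AB|w [nA Aw|Bw _]] /=.
- by have [/AB|] := pselect (A w); [right|left].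
- by have := nA Aw.
- exact: Bw.
Qed.

Lemma measurable_bool_set (b : T -> bool) :
  measurable_fun setT b -> measurable [set w | b w].
Proof.
by move=> mb; rewrite -[mkset _]setTI; apply: (mb measurableT [set true]).
Qed.

Lemma measurable_le_set (R : realType) (f g : T -> R) :
  measurable_fun setT f -> measurable_fun setT g ->
  measurable [set w | f w <= g w].
Proof.
by move=> mf mg; apply: measurable_bool_set; exact: measurable_fun_ler.
Qed.

Lemma measurable_natb (R : realType) (b : T -> bool) :
  measurable_fun setT b -> measurable_fun setT (fun w => (b w)%:R : R).
Proof.
move=> mb; rewrite (_ : (fun w => _) = (fun w => if b w then 1 else 0 : R)).
  by apply: measurable_fun_ifT.
by apply/funext => w; case: (b w).
Qed.

End FiniteMeasurability.

Section FiniteFamilies.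
Context d (T : measurableType d) (R : realType) (P : probability T R).

Lemma prob_exists_le (I : finType) (Q : I -> T -> Prop) :
  (forall i, measurable [set w | Q i w]) ->
  (P [set w | exists i, Q i w] <= \sum_i P [set w | Q i w])%E.
Proof.
move=> mQ; have -> : [set w | exists i, Q i w] =
    \big[setU/set0]_(i : I) [set w | Q i w].
  apply/seteqP; split => [w [i Qi]|w]; first by rewrite (bigD1 i) //; left.
  by elim/big_ind : _ => // [A B IA IB []//|i _ Qi]; exists i.
elim: index_enum => [|i s IH]; first by rewrite !big_nil measure0.
rewrite !big_cons; apply: le_trans (measureU2 _ _ _) (leeD _ _) => //.
exact: bigsetU_measurable.
Qed.

Lemma sum_probE (I : finType) (A : I -> set T) : (forall i, measurable (A i)) ->
  (\sum_i P (A i) = \int[P]_w (\sum_i \1_(A i) w)%:E)%E.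
Proof.
move=> mA; under eq_integral do rewrite -sumEFin.
rewrite ge0_integral_sum //=.
- by apply: eq_bigr => i _; rewrite integral_indic // setIT.
- by move=> i; apply/measurable_EFinP; exact: measurable_indic.
Qed.

(** Markov's inequality for the number of events A i that occur. *)
Lemma markov_count (I : finType) (A : I -> set T) (B : set T) (c : R) :
  (forall i, measurable (A i)) -> measurable B -> 0 <= c ->
  (forall w, B w -> c <= \sum_i \1_(A i) w) ->
  (c%:E * P B <= \sum_i P (A i))%E.
Proof.
move=> mA mB c0 cB; rewrite sum_probE // -[X in P X]setIT -integral_indic //.
rewrite -ge0_integralZl_EFin //; last first.
  by apply/measurable_EFinP; exact: measurable_indic.
apply: ge0_le_integral => //.
- by move=> w _; rewrite -EFinM lee_fin mulr_ge0.
- by apply/measurable_EFinP; apply: measurable_funM => //;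
    exact: measurable_indic.
- by apply/measurable_EFinP; apply: measurable_sum => i; exact: measurable_indic.
move=> w _; rewrite -EFinM lee_fin [in leLHS]indicE.
have [/set_mem/cB|] := boolP (w \in B); first by rewrite mulr1.
by rewrite mulr0 => _; apply: sumr_ge0.
Qed.

Lemma sum_prob_le (I : finType) (A : I -> set T) (c : R) :
  (forall i, measurable (A i)) ->
  (forall w, \sum_i \1_(A i) w <= c) ->
  (\sum_i P (A i) <= c%:E)%E.
Proof.
move=> mA cA; rewrite sum_probE //.
have -> : c%:E = (\int[P]_w (cst c%:E w))%E.
  rewrite integral_cst // [X in (_ * X)%E](_ : _ = 1%E) ?mule1 //.
  exact: probability_setT.
apply: ge0_le_integral => //.
- by move=> w _; rewrite lee_fin; apply: sumr_ge0.
- by apply/measurable_EFinP; apply: measurable_sum => i; exact: measurable_indic.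
- by move=> w _; rewrite lee_fin.
Qed.

End FiniteFamilies.

(** * Exchangeability of the columns *)

Section Configurations.
Context (R : realType) (n : nat).
Implicit Types (A : edge n -> set R) (C : edge n -> set bool).

Definition box A C : set ((edge n -> R) * (edge n -> bool)) :=
  [set f | forall e, A e (f.1 e) /\ C e (f.2 e)].

Definition boxes : set (set ((edge n -> R) * (edge n -> bool))) :=
  [set B | exists A C, (forall e, measurable (A e)) /\ B = box A C].

(** The space of outcomes (costs, colours) with the product sigma-algebra: the
    boxes form a generating pi-system. *)
Definition config := g_sigma_algebraType boxes.

Lemma boxes_setI : setI_closed boxes.
Proof.
move=> _ _ [A [C [mA ->]]] [A' [C' [mA' ->]]].
exists (fun e => A e `&` A' e), (fun e => C e `&` C' e); split.
  by move=> e; apply: measurableI.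
apply/seteqP; split => [f [fA fA'] e|f fAA'].
  by have [? ?] := fA e; have [? ?] := fA' e.
by split=> e; have [[? ?] [? ?]] := fAA' e.
Qed.

Lemma measurable_cost_coord (e : edge n) :
  measurable_fun setT (fun f : config => f.1 e).
Proof.
move=> _ B mB; rewrite setTI; apply: sub_sigma_algebra.
exists (fun e' => if e' == e then B else setT), (fun _ => setT); split.
  by move=> e'; case: ifP.
apply/seteqP; split => [f Bf e'|f /(_ e)[]]; last by rewrite eqxx.
by split=> //; case: eqP => // ->.
Qed.

Lemma measurable_colour_coord (e : edge n) :
  measurable_fun setT (fun f : config => f.2 e).
Proof.
move=> _ B mB; rewrite setTI; apply: sub_sigma_algebra.
exists (fun _ => setT), (fun e' => if e' == e then B else setT); split.
  by [].
apply/seteqP; split => [f Bf e'|f /(_ e)[_]]; last by rewrite eqxx.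
by split=> //; case: eqP => // ->.
Qed.

(** Dynkin's pi-lambda theorem for the pi-system of boxes. *)
Lemma eq_law d (T : measurableType d) (P : probability T R)
    (Y Y' : T -> config) :
  measurable_fun setT Y -> measurable_fun setT Y' ->
  (forall B, boxes B -> P (Y @^-1` B) = P (Y' @^-1` B)) ->
  forall B : set config, measurable B -> P (Y @^-1` B) = P (Y' @^-1` B).
Proof.
move=> mY mY' eqB B mB.
have mpre (Z : T -> config) S : measurable_fun setT Z -> measurable S ->
    measurable (Z @^-1` S).
  by move=> mZ mS; rewrite -[_ @^-1` _]setTI; apply: mZ.
apply: (@dynkin_induction _ config boxes
  (fun S => P (Y @^-1` S) = P (Y' @^-1` S))) => //.
- exact: boxes_setI.
- move=> S mS PS; rewrite -(preimage_setC Y) -(preimage_setC Y').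
  by rewrite !probability_setC ?PS //; apply: mpre.
- move=> F mF /trivIsetP tF PF.
  have tpre (Z : T -> config) : trivIset setT (fun k => Z @^-1` F k).
    apply/trivIsetP => i j _ _ /(tF i j I I) F0.
    by rewrite -preimage_setI F0 preimage_set0.
  rewrite !preimage_bigcup !measure_bigcup //.
  + by apply: eq_eseriesr => k _; apply: PF.
  + by move=> k _; apply: mpre.
  + by move=> k _; apply: mpre.
Qed.

End Configurations.

Section Model.
Context (R : realType) (n : nat) d (T : measurableType d) (P : probability T R).
Context (X : edge n -> {RV P >-> R}) (col : edge n -> {RV P >-> bool}).
Lemma measurable_cost_event e (A : set R) : measurable A ->
  measurable (X e @^-1` A).
Proof.
move=> mA; rewrite -[_ @^-1` _]setTI.
exact: (measurable_funP (X e) measurableT).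
Qed.

Lemma measurable_colour_event e (A : set bool) : measurable (col e @^-1` A).
Proof.
by rewrite -[_ @^-1` _]setTI; exact: (measurable_funP (col e) measurableT).
Qed.

Hypothesis model : random_costs_colours X col.

(** A e and C e may be the full sets, so the family of all edges also yields
    the product formula for every subfamily. *)
Lemma prob_box (A : edge n -> set R) (C : edge n -> set bool) :
  (forall e, measurable (A e)) ->
  P [set w | forall e, A e (X e w) /\ C e (col e w)] =
  (\prod_e (P (X e @^-1` A e) * P (col e @^-1` C e)))%E.
Proof.
move=> mA; have [_ _ indep] := model.
pose E (k : edge n + edge n) :=
  match k with inl e => X e @^-1` A e | inr e => col e @^-1` C e end.
have := indep [set: edge n + edge n]%SET E.
rewrite (_ : \bigcap_(i in _) _ =
  [set w | forall e, A e (X e w) /\ C e (col e w)]).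
  move=> ->; last first.
    by move=> [e|e] _ /=; [exists (A e)|exists (C e)]; rewrite ?setTI.
  rewrite (eq_bigl xpredT) => [|k]; last by rewrite inE.
  by rewrite big_sumType /= -big_split.
apply/seteqP; split => [w Ew e|w Ew [e|e] _ /=].
- by split; [apply: (Ew (inl e))|apply: (Ew (inr e))]; rewrite /= inE.
- by have [] := Ew e.
- by have [] := Ew e.
Qed.

Definition column_shuffle (s : {perm 'I_n}) (e : edge n) : edge n :=
  (e.1, s e.2).

Definition configuration (s : {perm 'I_n}) (w : T) : config R n :=
  (fun e => X (column_shuffle s e) w, fun e => col (column_shuffle s e) w).

Lemma column_shuffleK s : cancel (column_shuffle s) (column_shuffle s^-1).
Proof. by case=> i j; rewrite /column_shuffle /= permK. Qed.

Lemma column_shuffleVK s : cancel (column_shuffle s^-1) (column_shuffle s).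
Proof. by case=> i j; rewrite /column_shuffle /= permKV. Qed.

Lemma measurable_configuration s : measurable_fun setT (configuration s).
Proof.
apply: (@measurability _ _ T (config R n) setT _ (@boxes R n) erefl).
move=> _ [_ [A [C [mA ->]]] <-]; rewrite setTI; apply: measurable_forall => e.
exact: measurableI (measurable_cost_event (column_shuffle s e) (mA e))
                   (measurable_colour_event (column_shuffle s e) (C e)).
Qed.

(** On a box both sides are products of the same factors in another order. *)
Lemma configuration_law s (B : set (config R n)) : measurable B ->
  P (configuration s @^-1` B) = P (configuration 1 @^-1` B).
Proof.
move: B; apply: eq_law; [exact: measurable_configuration..|].
have lawE t A C : (forall e, measurable (A e)) ->
  P (configuration t @^-1` box A C) =
  (\prod_e (exponential_prob 1 (A e) * bernoulli_prob 2^-1 (C e)))%E.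
  move=> mA; have [mX mC _] := model.
  pose t' := column_shuffle t^-1.
  transitivity (P [set w | forall e, A (t' e) (X e w) /\ C (t' e) (col e w)]).
    congr (P _); apply/seteqP; split => w /= Aw e.
      by have := Aw (t' e); rewrite /configuration /= column_shuffleVK.
    by have := Aw (column_shuffle t e); rewrite /t' column_shuffleK.
  rewrite (prob_box (A := fun e => A (t' e)) (fun e => C (t' e))) => [|e];
    last exact: mA.
  rewrite (reindex (column_shuffle t)) /=; last first.
    by exists t' => e _; [exact: column_shuffleK|exact: column_shuffleVK].
  apply: eq_bigr => e _; rewrite /t' column_shuffleK.
  by rewrite -(mX (column_shuffle t e) _ (mA e)) -(mC (column_shuffle t e)).
by move=> _ [A [C [mA ->]]]; rewrite !lawE.
Qed.

End Model.

(** * The number of cycles of an optimal permutation *)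

Section OptimalPermutations.
Context (R : realType) (n : nat) (alpha : R).
Implicit Types (x : edge n -> R) (c : edge n -> bool) (t : {perm 'I_n}).

Definition perm_cost x t : R := \sum_i x (i, t i).
Definition perm_reds c t : R := \sum_i (c (i, t i))%:R.

Definition optimal x c t : Prop :=
  perm_reds c t <= alpha * n%:R /\
  forall u, perm_reds c u <= alpha * n%:R -> perm_cost x t <= perm_cost x u.

Definition many_cycles t : bool := (n.+1 ^ 2 <= 2 ^ #|porbits t|)%N.

(** Outcomes without any optimal permutation are excluded here: that case is
    ruled out by the graph of cheap blue edges and not by symmetry. *)
Definition tangled x c : Prop :=
  (exists t, optimal x c t) /\ forall t, optimal x c t -> many_cycles t.

Lemma optimal_shuffle x c s t :
  optimal (x \o column_shuffle s) (c \o column_shuffle s) t <->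
  optimal x c (t * s)%g.
Proof.
have costE u : perm_cost (x \o column_shuffle s) u = perm_cost x (u * s)%g.
  by apply: eq_bigr => i _; rewrite /= /column_shuffle /= permM.
have redE u : perm_reds (c \o column_shuffle s) u = perm_reds c (u * s)%g.
  by apply: eq_bigr => i _; rewrite /= /column_shuffle /= permM.
rewrite /optimal costE redE; split=> -[redt opt]; split=> // u redu.
  by have := opt (u * s^-1)%g; rewrite costE redE mulgKV; apply.
by rewrite costE; apply: opt; rewrite -redE.
Qed.

Lemma measurable_tangled :
  measurable [set f : config R n | tangled f.1 f.2].
Proof.
have mred t : measurable [set f : config R n | perm_reds f.2 t <= alpha * n%:R].
  apply: measurable_le_set => //; apply: measurable_sum => i.
  by apply: measurable_natb; exact: measurable_colour_coord.
have mopt t : measurable [set f : config R n | optimal f.1 f.2 t].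
  apply: (measurableI _ _ (mred t)); apply: measurable_forall => u.
  apply: measurable_imply => //; apply: measurable_le_set;
    apply: measurable_sum => i; exact: measurable_cost_coord.
apply: (@measurableI _ _ [set f : config R n | exists t, optimal f.1 f.2 t]).
  exact: measurable_exists.
apply: measurable_forall => t; apply: measurable_imply => //.
by apply: measurable_bool_set; exact: measurable_cst.
Qed.

Context d (T : measurableType d) (P : probability T R).
Context (X : edge n -> {RV P >-> R}) (col : edge n -> {RV P >-> bool}).
Hypothesis model : random_costs_colours X col.

(** If t0 is optimal for the outcome w, the permutations that are optimal for
    the shuffled outcome include t0 followed by the inverse of the shuffle; as
    the shuffle varies this runs once through all permutations, few of which
    have many cycles. *)
Lemma card_tangled_shuffles w :
  (#|[set s : {perm 'I_n} |
      `[< tangled (configuration X col s w).1 (configuration X col s w).2 >]]%SET|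
   * n.+1 <= n`!)%N.
Proof.
have cfgE s : configuration X col s w =
  ((fun e => X e w) \o column_shuffle s, (fun e => col e w) \o column_shuffle s).
  by [].
have := card_many_cycles 'I_n; rewrite card_ord; apply: leq_trans.
rewrite leq_mul2r; apply/orP; right.
have [[t0 opt0]|no] := pselect (exists t, optimal (X ^~ w) (col ^~ w) t);
    last first.
  rewrite (_ : [set s | _]%SET = finset.set0) ?cards0 //.
  apply/setP => s; rewrite !inE; apply/negbTE/asboolPn => -[[t]].
  by rewrite cfgE => /optimal_shuffle opt _; apply: no; exists (t * s)%g.
(* Composing t0 with the inverse of s gives an optimal permutation of the
   relabelled outcome, and different s give different ones. *)
rewrite -(@card_imset _ _ (fun s : {perm 'I_n} => t0 * s^-1)%g); last first.
  by move=> s s' /mulgI /invg_inj.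
apply/subset_leq_card/fintype.subsetP => _ /imsetP[s + ->].
rewrite !inE => -[_]; apply.
by apply/(optimal_shuffle (X ^~ w) (col ^~ w) s); rewrite mulgKV.
Qed.

(** All shuffles of the columns give the event the same probability, so this is
    the average over the shuffles, which is bounded outcome by outcome. *)
Lemma prob_tangled :
  measurable [set w | tangled (X ^~ w) (col ^~ w)] /\
  (P [set w | tangled (X ^~ w) (col ^~ w)] <= (n.+1%:R^-1)%:E)%E.
Proof.
pose B : set (config R n) := [set f | tangled f.1 f.2].
have mB s : measurable (configuration X col s @^-1` B).
  rewrite -[_ @^-1` _]setTI; apply: measurable_configuration => //.
  exact: measurable_tangled.
have -> : [set w | tangled (X ^~ w) (col ^~ w)] = configuration X col 1 @^-1` B.
  apply/seteqP; split => w; rewrite /B /configuration /= /column_shuffle.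
    by move=> tw; under eq_fun do rewrite perm1 -surjective_pairing;
      under [X in tangled _ X]eq_fun do rewrite perm1 -surjective_pairing.
  by under eq_fun do rewrite perm1 -surjective_pairing;
      under [X in tangled _ X]eq_fun do rewrite perm1 -surjective_pairing.
split=> //.
have : (\sum_(s : {perm 'I_n}) P (configuration X col s @^-1` B) <=
        (n`!%:R / n.+1%:R)%:E)%E.
  apply: sum_prob_le => // w; rewrite ler_pdivlMr //.
  rewrite (eq_bigr (fun s => (s \in [set s : {perm 'I_n} |
      `[< tangled (configuration X col s w).1
                  (configuration X col s w).2 >]]%SET)%:R)); last first.
    move=> s _; rewrite indicE; congr ((nat_of_bool _)%:R).
    by apply/idP/idP; rewrite !inE.
  rewrite -natr_sum -natrM ler_nat; apply: leq_trans (card_tangled_shuffles w).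
  rewrite leq_mul2r -sum1_card [leqRHS]big_mkcond; apply/orP; right.
  by apply: leq_sum => s _; case: ifP.
rewrite (eq_bigr (fun=> P (configuration X col 1 @^-1` B))); last first.
  by move=> s _; exact: (configuration_law model s measurable_tangled).
rewrite -(fineK (fin_num_measure P _ (mB 1%g))) sumEFin sumr_const cardT.
rewrite -cardE card_Sn !lee_fin -[_ *+ _]mulr_natl.
by rewrite ler_pM2l.
Qed.

End OptimalPermutations.

(** * The random graph of cheap blue edges *)

(** Larger sets are cut down to the exact sizes, so a union bound over sets of
    these sizes is enough. *)
Lemma joined_of_exact (T : finType) (G : rel T) a b :
  (forall S U : {set T}, #|S| = a -> #|U| = b ->
    exists x y, [/\ x \in S, y \in U & G x y]) -> joined G a b.
Proof.
move=> J S U aS bU.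
pose first k (V : {set T}) : {set T} := [set x in take k (enum V)]%SET.
have firstS k V x : x \in first k V -> x \in V.
  by rewrite inE => /mem_take; rewrite mem_enum.
have card_first k (V : {set T}) : (k <= #|V|)%N -> #|first k V| = k.
  move=> kV; rewrite cardsE (card_uniqP _) ?take_uniq ?enum_uniq //.
  by rewrite size_takel // -cardE.
have [x [y [xS yU Gxy]]] := J _ _ (card_first _ _ aS) (card_first _ _ bU).
by exists x, y; split=> //; [apply: firstS xS|apply: firstS yU].
Qed.

(** Otherwise the singleton of u and the set of its non-neighbours would be
    joined. *)
Lemma joined_outdeg (T : finType) (G : rel T) m u :
  joined G 1 (#|T| - m) -> (m < #|[set y | G u y]%SET|)%N.
Proof.
move=> J; rewrite ltnNge; apply/negP => small.
have [||x [y []]] := J [set u]%SET (~: [set y | G u y])%SET.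
- by rewrite cards1.
- by rewrite [#|~: _|%SET]cardsCs finset.setCK leq_sub2l.
by rewrite !inE => /eqP-> /negbTE->.
Qed.

Lemma joined_indeg (T : finType) (G : rel T) m v :
  joined G (#|T| - m) 1 -> (m < #|[set x | G x v]%SET|)%N.
Proof.
move=> J; apply: (@joined_outdeg T (fun x y => G y x)) => S U S1 Um.
by have [x [y [xU yS Gxy]]] := J U S Um S1; exists y, x.
Qed.

Section ExponentialCosts.
Context (R : realType) (n : nat) d (T : measurableType d) (P : probability T R).
Context (X : edge n -> {RV P >-> R}) (col : edge n -> {RV P >-> bool}).
Hypothesis model : random_costs_colours X col.

Lemma prob_cost_neg e : P [set w | X e w < 0] = 0%E.
Proof.
have [law _ _] := model.
have -> : [set w | X e w < 0] = X e @^-1` `]-oo, 0[.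
  by apply/seteqP; split => w; rewrite /= in_itv.
have := law e `]-oo, 0[%classic (measurable_itv _).
rewrite /distribution /pushforward => ->.
apply: integral0_eq => x /=; rewrite in_itv /= => x0.
by rewrite lt0_exponential_pdf.
Qed.

Lemma prob_cost_le e (a : R) : 0 < a ->
  P (X e @^-1` `[0, a]) = (1 - expR (- a))%:E.
Proof.
move=> a0; have [law _ _] := model.
have := law e `[0, a]%classic (measurable_itv _).
rewrite /distribution /pushforward => ->.
by rewrite exponential_prob_itv0c // mulN1r EFinB.
Qed.

Lemma prob_red e : P (col e @^-1` [set true]) = (2^-1)%:E.
Proof.
have [_ law _] := model; have := law e [set true].
rewrite /distribution /pushforward => ->.
rewrite /bernoulli_prob ifT; last by apply/andP; split; lra.
by rewrite fsbig_set1.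
Qed.

Definition cheap (a : R) (w : T) : rel 'I_n :=
  fun i j => ~~ col (i, j) w && (X (i, j) w \in `[0, a]).

(** Being cheap involves the cost and the colour of an edge, while independence
    is stated for costs and colours separately. The event is therefore covered
    by boxes, one for each set of edges of cost above a, and the sum of their
    probabilities factors over the edges. *)
Lemma prob_no_cheap (a : R) (D : {set edge n}) : 0 < a ->
  measurable [set w | forall e, e \in D -> ~~ cheap a w e.1 e.2] /\
  (P [set w | forall e, e \in D -> ~~ cheap a w e.1 e.2] <=
   ((1 - (1 - expR (- a)) / 2) ^+ #|D|)%:E)%E.
Proof.
move=> a0; set p := 1 - expR (- a).
have mN : measurable [set w | forall e, e \in D -> ~~ cheap a w e.1 e.2].
  apply: measurable_forall => -[i j]; apply: measurable_imply.
    by apply: measurable_bool_set; exact: measurable_cst.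
  have -> : [set w | ~~ cheap a w (i, j).1 (i, j).2] =
     (col (i, j) @^-1` [set true]) `|` ~` (X (i, j) @^-1` `[0, a]).
    apply/seteqP; split => w; rewrite /cheap /= negb_and negbK.
      by case/orP => [->|/negP]; [left|right].
    by case=> [->//|/negP->]; rewrite orbT.
  apply: measurableU; first exact: measurable_colour_event.
  by apply: measurableC; apply: measurable_cost_event; exact: measurable_itv.
split=> //.
(* f marks the edges of D whose cost exceeds a; the others must be red. Outside D
   the mark true puts no condition, and the mark false gives the empty event, so
   that each edge contributes a sum over bool. *)
pose A (f : {ffun edge n -> bool}) e : set R :=
  if e \in D then if f e then ~` [set` `[0, a]] else [set` `[0, a]]
  else if f e then setT else set0.
pose C (f : {ffun edge n -> bool}) e : set bool :=
  if (e \in D) && ~~ f e then [set true] else setT.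
pose g e (b : bool) : R :=
  if e \in D then if b then 1 - p else p / 2 else b%:R.
have mA f e : measurable (A f e).
  rewrite /A; case: ifP => _; case: (f e) => //; try exact: measurable_itv.
  by apply: measurableC; exact: measurable_itv.
have mR f : measurable [set w | forall e, A f e (X e w) /\ C f e (col e w)].
  apply: measurable_forall => e.
  exact: measurableI (measurable_cost_event X e (mA f e))
                     (measurable_colour_event col e (C f e)).
apply: (@le_trans _ _
  (\sum_f P [set w | forall e, A f e (X e w) /\ C f e (col e w)])%E).
  apply: le_trans (prob_exists_le _ mR); apply: le_measure; rewrite ?inE //.
    exact: measurable_exists.
  move=> w no; exists [ffun e => (e \in D) ==> (X e w \notin `[0, a])] => e.
  rewrite /A /C !ffunE; case: (boolP (e \in D)) => [eD|//] /=.
  case: (boolP (X e w \in `[0, a])) => Xe /=; split=> //; last first.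
    by move=> /= XI; rewrite XI in Xe.
  by have := no e eD; rewrite /cheap -surjective_pairing Xe andbT negbK => ->.
have probE f : P [set w | forall e, A f e (X e w) /\ C f e (col e w)] =
    (\prod_e g e (f e))%:E.
  rewrite (prob_box model) // -prodEFin; apply: eq_bigr => e _.
  rewrite /A /C /g; case: ifP => eD /=; last first.
    by case: (f e); rewrite ?preimage_setT ?preimage_set0 ?probability_setT
                            ?measure0 ?mule1 ?mul0e.
  case: (f e) => /=.
    rewrite preimage_setT probability_setT mule1 -preimage_setC.
    rewrite probability_setC ?prob_cost_le ?EFinB //.
    by apply: measurable_cost_event; exact: measurable_itv.
  by rewrite prob_cost_le // prob_red -EFinM.
rewrite (eq_bigr (fun f : {ffun edge n -> bool} => (\prod_e g e (f e))%:E)) //.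
rewrite sumEFin -bigA_distr_bigA lee_fin.
have -> : \prod_e \sum_(b : bool) g e b = \prod_(e in D) (1 - p / 2).
  rewrite [RHS]big_mkcond; apply: eq_bigr => e _; rewrite big_bool /g.
  case: ifP => _ /=; last by rewrite addr0.
  by rewrite {1}[p]splitr opprD -!addrA addNr addr0.
by rewrite prodr_const.
Qed.

(** Union bound over all pairs of sets of k and l vertices. *)
Lemma prob_not_joined (a : R) (k l : nat) : 0 < a ->
  exists B : set T, [/\ measurable B,
    forall w, ~ B w -> joined (cheap a w) k l
  & (P B <= ('C(n, k)%:R * 'C(n, l)%:R *
       (1 - (1 - expR (- a)) / 2) ^+ (k * l))%:E)%E].
Proof.
move=> a0; pose Q (SU : {set 'I_n} * {set 'I_n}) w : Prop :=
  [/\ #|SU.1| = k, #|SU.2| = l &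
      forall e, e \in finset.setX SU.1 SU.2 -> ~~ cheap a w e.1 e.2].
have QE SU : [set w | Q SU w] = if (#|SU.1| == k) && (#|SU.2| == l) then
    [set w | forall e, e \in finset.setX SU.1 SU.2 -> ~~ cheap a w e.1 e.2]
    else set0.
  case: ifP => [/andP[/eqP sk /eqP sl]|no].
    by apply/seteqP; split => [w []|w].
  by apply/seteqP; split => [w [sk sl]|//]; move: no; rewrite sk sl !eqxx.
have mQ SU : measurable [set w | Q SU w].
  rewrite QE; case: ifP => // _.
  by case: (prob_no_cheap (finset.setX SU.1 SU.2) a0).
exists [set w | exists SU, Q SU w]; split; first exact: measurable_exists.
- move=> w nB; apply: joined_of_exact => S U Sk Ul.
  apply: contrapT => no; apply: nB; exists (S, U); split=> // -[x y].
  rewrite finset.in_setX => /andP[/= xS yU]; apply/negP => Gxy.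
  by apply: no; exists x, y.
apply: le_trans (prob_exists_le _ mQ) _.
set q := _ ^+ _.
have card_sizes m : #|[set S : {set 'I_n} | #|S| == m]%SET| = 'C(n, m).
  by rewrite card_draws card_ord.
apply: (@le_trans _ _ (\sum_(SU in finset.setX
    [set S : {set 'I_n} | #|S| == k]%SET
    [set S : {set 'I_n} | #|S| == l]%SET) q%:E)%E).
  rewrite [leRHS]big_mkcond; apply: lee_sum => -[S U] _.
  rewrite QE finset.in_setX !inE /=.
  case: ifP => [/andP[/eqP sk /eqP sl]|_]; last by rewrite measure0.
  have [_] := prob_no_cheap (finset.setX S U) a0.
  by rewrite cardsX sk sl.
by rewrite sumEFin sumr_const cardsX !card_sizes -natrM mulr_natl.
Qed.

End ExponentialCosts.

(** * Perfect matchings and tours as permutations *)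

Section Graphs.
Variable n : nat.
Implicit Types t : {perm 'I_n}.

Definition perm_graph t : {set edge n} := [set (i, t i) | i : 'I_n]%SET.

Lemma mem_perm_graph t i j : ((i, j) \in perm_graph t) = (j == t i).
Proof.
by apply/imsetP/eqP => [[k _ [-> ->]]//|->]; exists i.
Qed.

Lemma perm_graph_matching t : is_perfect_matching (perm_graph t).
Proof.
apply/andP; split; apply/forallP => i; apply/cards1P.
  exists (i, t i); apply/setP => -[j k]; rewrite !inE mem_perm_graph /= xpair_eqE.
  by rewrite andbC; case: eqP => //= ->.
exists ((t^-1)%g i, i); apply/setP => -[j k].
rewrite !inE mem_perm_graph /= xpair_eqE andbC [RHS]andbC; case: (k =P i) => //= ->.
by apply/eqP/eqP => ->; rewrite ?permK ?permKV.
Qed.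

Lemma perfect_matchingP (M : {set edge n}) :
  is_perfect_matching M -> exists t, M = perm_graph t.
Proof.
move=> /andP[/forallP rows /forallP cols].
have row i : {j | forall e, (e \in M) && (e.1 == i) = (e == (i, j))}.
  apply: cid; have /cards1P[[i' j] /setP E] := rows i.
  have := E (i', j); rewrite !inE eqxx => /andP[_ /= /eqP i'i].
  by exists j => e; have := E e; rewrite !inE i'i.
pose f i := sval (row i).
have fM i j : ((i, j) \in M) = (j == f i).
  by have := svalP (row i) (i, j); rewrite /= eqxx andbT xpair_eqE eqxx.
have f_inj : injective f.
  move=> i i' ff; have /cards1P[e /setP E] := cols (f i).
  have := E (i, f i); have := E (i', f i); rewrite !inE !fM eqxx ff eqxx /=.
  by move=> /esym/eqP <- /esym/eqP[].
exists (perm f_inj); apply/setP => -[i j].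
by rewrite fM mem_perm_graph permE.
Qed.

Lemma cost_perm_graph (R : realType) (x : edge n -> R) t :
  cost x (perm_graph t) = perm_cost x t.
Proof. by rewrite /cost big_imset //= => i j _ _ []. Qed.

Lemma reds_perm_graph (R : realType) (c : edge n -> bool) t :
  #|[set e | c e]%SET :&: perm_graph t|%:R = perm_reds R c t.
Proof.
rewrite /perm_reds -natr_sum; congr (_%:R).
rewrite -sum1_card (eq_bigl (fun e => (e \in perm_graph t) && c e)); last first.
  by move=> e; rewrite !inE andbC.
rewrite big_mkcondr big_imset /=; last by move=> i j _ _ [].
by apply: eq_bigr => i _; case: (c _).
Qed.

Lemma tour_perm (s : seq 'I_n) : uniq s -> (forall v, v \in s) ->
  exists t : {perm 'I_n}, forall v, t v = next s v.
Proof.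
move=> Us As; have next_inj : injective (next s) := can_inj (prev_next Us).
by exists (perm next_inj) => v; rewrite permE.
Qed.

(** For n = 1 the single edge would be a loop. *)
Lemma perm_graph_tour (s : seq 'I_n) t : (1 < n)%N -> uniq s ->
  (forall v, v \in s) -> (forall v, t v = next s v) ->
  is_tour (perm_graph t).
Proof.
move=> n1 Us As tE.
have sz : size s == n.
  rewrite -(card_uniqP Us) -[X in _ == X]card_ord.
  by apply/eqP/eq_card => v; rewrite As.
apply/andP; split.
  apply/forall_inP => -[i j]; rewrite mem_perm_graph tE => /eqP -> /=.
  apply/eqP => fix_i; have [k p rE] := rot_to (As i).
  have : next (rot k s) i = i by rewrite next_rot.
  have Ur : uniq (i :: p) by rewrite -rE rot_uniq.
  have : size (i :: p) = n by rewrite -rE size_rot; exact/eqP.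
  rewrite rE; case: p {rE} Ur => [_ sz1|j' p].
    by rewrite -[X in (1 < X)%N]sz1 in n1.
  move=> + _; rewrite /= eqxx inE negb_or => /andP[/andP[/eqP + _] _].
  by congruence.
apply/existsP; exists (Tuple sz); rewrite /= Us; apply/eqP.
by apply: eq_imset => v; rewrite tE.
Qed.

Lemma tour_is_perm_graph (T : {set edge n}) :
  is_tour T -> exists t, T = perm_graph t.
Proof.
move=> /andP[_ /existsP[s /andP[Us /eqP ->]]].
have As v : v \in s.
  have cs : #|s| = #|'I_n| by rewrite (card_uniqP Us) size_tuple card_ord.
  by rewrite (subset_cardP cs (subset_predT _)).
have [t tE] := tour_perm Us As; exists t.
by apply: eq_imset => v; rewrite tE.
Qed.

End Graphs.

(** * Comparison of the two minima for given costs and colours *)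

Section Outcome.
Context (R : realType) (n : nat) (alpha : R).
Variables (x : edge n -> R) (c : edge n -> bool).
Let red : {set edge n} := [set e | c e]%SET.
Hypothesis alpha_ge0 : 0 <= alpha.

Lemma Z_PM_optimal t : optimal alpha x c t ->
  Z_PM alpha x red = (perm_cost x t)%:E.
Proof.
move=> [redt opt]; apply/eqP; rewrite eq_le; apply/andP; split.
  rewrite -cost_perm_graph; apply: bigmin_le_cond.
  by rewrite perm_graph_matching reds_perm_graph.
apply: le_bigmin => [|M /andP[/perfect_matchingP[u ->]]]; first exact: leey.
by rewrite reds_perm_graph cost_perm_graph lee_fin => /opt.
Qed.

Lemma Z_PM_le_ATSP : (Z_PM alpha x red <= Z_ATSP alpha x red)%E.
Proof.
apply: le_bigmin => [|S /andP[/tour_is_perm_graph[u ->] redu]].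
  exact: bigmin_le_id.
by apply: bigmin_le_cond; rewrite perm_graph_matching.
Qed.

Hypothesis n_gt1 : (1 < n)%N.

Lemma Z_ATSP_le (s : seq 'I_n) : uniq s -> (forall v, v \in s) ->
  \sum_v (c (v, next s v))%:R <= alpha * n%:R ->
  (Z_ATSP alpha x red <= (\sum_v x (v, next s v))%:E)%E.
Proof.
move=> Us As; have [t tE] := tour_perm Us As.
have -> : \sum_v (c (v, next s v))%:R = perm_reds R c t.
  by apply: eq_bigr => v _; rewrite tE.
have -> : \sum_v x (v, next s v) = perm_cost x t.
  by apply: eq_bigr => v _; rewrite tE.
move=> redt; rewrite -cost_perm_graph; apply: bigmin_le_cond.
by rewrite (perm_graph_tour n_gt1 Us As tE) reds_perm_graph.
Qed.

Variables (theta : R) (s : nat).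
Let G : rel 'I_n := fun i j => ~~ c (i, j) && (x (i, j) \in `[0, theta]).
Hypothesis x_ge0 : forall e, 0 <= x e.
Hypothesis G_expanding : expanding G s.

(** A tour inside G has no red edge, so it is admissible for every alpha. *)
Lemma exists_optimal : exists t, optimal alpha x c t.
Proof.
pose i0 : 'I_n := Ordinal (ltnW n_gt1).
have [p [Up Ap Gp]] := tour_inside G_expanding i0.
have [t0 t0E] := tour_perm Up Ap.
have red0 : perm_reds R c t0 <= alpha * n%:R.
  rewrite /perm_reds big1 ?mulr_ge0 // => v _.
  by rewrite t0E; have /andP[/negbTE->] := Gp v.
pose ok t := perm_reds R c t <= alpha * n%:R.
have [t okt tmin] :=
  @Order.TotalTheory.arg_minP _ R _ t0 ok (perm_cost x) red0.
by exists t.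
Qed.

(** The edges added by tour_near_perm are blue, so the bound on the red edges
    is kept, and each of them costs at most theta. *)
Lemma Z_ATSP_le_near t : perm_reds R c t <= alpha * n%:R ->
  (Z_ATSP alpha x red <= (perm_cost x t + (12 * #|porbits t|)%:R * theta)%:E)%E.
Proof.
move=> redt; pose i0 : 'I_n := Ordinal (ltnW n_gt1).
have [p [Up Ap near far]] := tour_near_perm G_expanding i0 t.
have step v : next p v != t v -> G v (next p v).
  by move=> nv; have := near v; rewrite (negbTE nv).
have theta0 : 0 <= theta.
  have [j] : exists j, j \in [set y | G i0 y]%SET.
    have [s_gt0 _ outdeg _] := G_expanding; apply/set0Pn; rewrite -card_gt0.
    by apply: leq_trans (outdeg i0); rewrite muln_gt0.
  by rewrite inE => /andP[_]; rewrite in_itv /= => /andP[]; apply: le_trans.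
apply: (le_trans (Z_ATSP_le Up Ap _)).
  apply: le_trans redt; apply: ler_sum => v _.
  have [->//|/step /andP[/negbTE-> _]] := eqVneq (next p v) (t v).
  by rewrite ler0n.
rewrite lee_fin; apply: (@le_trans _ _ (perm_cost x t +
  \sum_(v in [set v | next p v != t v]%SET) theta)).
  rewrite [X in _ + X]big_mkcond -big_split /=; apply: ler_sum => v _.
  rewrite inE; have [->|/step /andP[_]] := eqVneq (next p v) (t v).
    by rewrite addr0.
  by rewrite in_itv /= => /andP[_ le]; apply: le_trans le _; rewrite lerDr.
rewrite lerD2l sumr_const -(mulr_natl theta) ler_wpM2r // ler_nat.
exact: far.
Qed.

(** At most n / 2 rows contain an edge of cost at most a; every other row
    contributes more than a. *)
Lemma perm_cost_ge (a : R) t : 0 <= a ->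
  \sum_e (x e \in `[0, a])%:R <= n%:R / 2 :> R ->
  a * (n%:R / 2) <= perm_cost x t.
Proof.
move=> a0 few; apply: (@le_trans _ _
  (\sum_(i < n) (a - a * (x (i, t i) \in `[0, a])%:R))).
  rewrite sumrB sumr_const card_ord -mulr_sumr -(mulr_natr a) -mulrBr.
  apply: ler_wpM2l => //.
  suff : \sum_(i < n) (x (i, t i) \in `[0, a])%:R <= n%:R / 2 :> R by lra.
  apply: le_trans few.
  rewrite -(big_imset (fun e => (x e \in `[0, a])%:R)) /=; last first.
    by move=> i j _ _ [].
  rewrite [leRHS](bigID (mem [set (i, t i) | i : 'I_n]%SET)) /=.
  by rewrite lerDl sumr_ge0.
apply: ler_sum => i _; rewrite in_itv /= x_ge0 /=.
by case: (lerP (x _) a) => [_|/ltW]; rewrite ?mulr1 ?subrr ?mulr0 ?subr0.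
Qed.

Lemma good_outcome (a eps : R) : 0 < a ->
  \sum_e (x e \in `[0, a])%:R <= n%:R / 2 :> R ->
  ~ tangled alpha x c ->
  (forall k, (2 ^ k < n.+1 ^ 2)%N ->
    (12 * k)%:R * theta <= eps * (a * (n%:R / 2))) ->
  0 <= eps ->
  [/\ Z_ATSP alpha x red \is a fin_num, Z_PM alpha x red \is a fin_num
    & (`|Z_ATSP alpha x red - Z_PM alpha x red| <= eps%:E * Z_PM alpha x red)%E].
Proof.
move=> a0 few not_tangled small eps0.
have [t opt few_cycles] : exists2 t, optimal alpha x c t & ~~ many_cycles t.
  apply: contrapT => no; apply: not_tangled; split; first exact: exists_optimal.
  by move=> t opt; apply: contrapT => /negP few_t; apply: no; exists t.
have PM := Z_PM_optimal opt; have le1 := Z_PM_le_ATSP.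
have le2 := Z_ATSP_le_near opt.1; rewrite PM in le1 *.
have fin : Z_ATSP alpha x red \is a fin_num.
  rewrite fin_numE; apply/andP; split.
    by apply: contraTN le1 => /eqP->.
  by apply: contraTN le2 => /eqP->.
split=> //; rewrite -(fineK fin) in le1 le2 *.
rewrite -EFinB abse_EFin -EFinM lee_fin; rewrite !lee_fin in le1 le2.
rewrite ger0_norm ?subr_ge0 // lerBlDl; apply: le_trans le2 _.
rewrite lerD2l; apply: le_trans (small _ _) _; first by rewrite ltnNge.
by apply: ler_wpM2l => //; apply: perm_cost_ge => //; exact: ltW.
Qed.

End Outcome.

(** * The probability that the two minima are close *)

Section MinCostMeasurability.
Context (R : realType) (n : nat) (alpha : R) d (T : measurableType d).
Context (P : probability T R).
Context (X : edge n -> {RV P >-> R}) (col : edge n -> {RV P >-> bool}).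

(** The range of the minimum depends on the outcome; giving the value +oo to
    the sets outside it makes it a minimum of measurable functions over a fixed
    range. *)
Lemma measurable_min_cost (adm : pred {set edge n}) :
  measurable_fun setT
    (fun w => min_cost adm alpha (fun e => X e w) (red_edges col w)).
Proof.
pose F S w : \bar R :=
  if adm S && (#|red_edges col w :&: S|%:R <= alpha * n%:R)
  then (cost (fun e => X e w) S)%:E else +oo%E.
have -> : (fun w => min_cost adm alpha (fun e => X e w) (red_edges col w)) =
    (fun w => \big[Order.min/+oo%E]_S F S w).
  by apply/funext => w; rewrite /min_cost bigmin_mkcond.
have mF S : measurable_fun setT (F S).
  rewrite /F; case: (adm S) => /=; last exact: measurable_cst.
  apply: measurable_fun_ifT; last exact: measurable_cst.
    apply: measurable_fun_ler; last exact: measurable_cst.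
    rewrite (_ : (fun w => _) = (fun w => \sum_(e <- enum S) (col e w)%:R)).
      by apply: measurable_sum => e; apply: measurable_natb.
    apply/funext => w; rewrite big_enum /= -natr_sum -sum1_card; congr (_%:R).
    rewrite (eq_bigl (fun e => (e \in S) && col e w)) ?big_mkcondr /=.
      by apply: eq_bigr => e _; case: (col e w).
    by move=> e; rewrite !inE andbC.
  apply/measurable_EFinP; rewrite /cost.
  rewrite (_ : (fun w => _) = (fun w => \sum_(e <- enum S) X e w)).
    by apply: measurable_sum => e.
  by apply/funext => w; rewrite big_enum.
elim: (index_enum _) => [|S r IH].
  rewrite (_ : (fun w => _) = cst +oo%E) //.
  by apply/funext => w; rewrite big_nil.
rewrite (_ : (fun w => _) =
  (fun w => Order.min (F S w) (\big[Order.min/+oo%E]_(S <- r) F S w))).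
  exact: measurable_mine.
by apply/funext => w; rewrite big_cons.
Qed.

Definition close_event (eps : R) : set T := [set w |
  [/\ Z_ATSP alpha (fun e => X e w) (red_edges col w) \is a fin_num,
      Z_PM alpha (fun e => X e w) (red_edges col w) \is a fin_num
    & (`|Z_ATSP alpha (fun e => X e w) (red_edges col w)
       - Z_PM alpha (fun e => X e w) (red_edges col w)|
       <= eps%:E * Z_PM alpha (fun e => X e w) (red_edges col w))%E]].

Lemma measurable_close_event (eps : R) : measurable (close_event eps).
Proof.
have mA := measurable_min_cost (@is_tour n).
have mM := measurable_min_cost (@is_perfect_matching n).
pose fin (f : T -> \bar R) := [set w | f w \is a fin_num].
have mfin f : measurable_fun setT f -> measurable (fin f).
  by move=> mf; rewrite -[fin f]setTI; exact: emeasurable_fin_num.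
have mle : measurable [set w | (`|Z_ATSP alpha (fun e => X e w) (red_edges col w)
       - Z_PM alpha (fun e => X e w) (red_edges col w)|
       <= eps%:E * Z_PM alpha (fun e => X e w) (red_edges col w))%E].
  rewrite -[mkset _]setTI; apply: measurable_lee => //.
    by apply: measurableT_comp => //; exact: emeasurable_funB.
  by apply: emeasurable_funM => //; exact: measurable_cst.
have := measurableI _ _ (mfin _ mA) (measurableI _ _ (mfin _ mM) mle).
by congr measurable; apply/seteqP; split => w /=; [case=> ? []|case].
Qed.

End MinCostMeasurability.

Section GoodProbability.
Context (R : realType) (n : nat) (alpha : R) d (T : measurableType d).
Context (P : probability T R).
Context (X : edge n -> {RV P >-> R}) (col : edge n -> {RV P >-> bool}).
Hypothesis model : random_costs_colours X col.
Hypothesis alpha_ge0 : 0 <= alpha.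

Lemma prob_some_neg : measurable [set w | exists e, X e w < 0] /\
  P [set w | exists e, X e w < 0] = 0%E.
Proof.
have mneg e : measurable [set w | X e w < 0].
  have -> : [set w | X e w < 0] = X e @^-1` `]-oo, 0[.
    by apply/seteqP; split => w; rewrite /= in_itv.
  by apply: measurable_cost_event; exact: measurable_itv.
split; first exact: measurable_exists.
apply/eqP; rewrite eq_le measure_ge0 andbT.
apply: le_trans (prob_exists_le _ mneg) _.
by rewrite big1 // => e _; rewrite (prob_cost_neg model).
Qed.

(** The expected number of edges of cost at most a is at most n ^ 2 * a. *)
Lemma prob_many_tiny (a : R) : (0 < n)%N -> 0 < a ->
  measurable [set w | n%:R / 2 <= \sum_e (X e w \in `[0, a])%:R :> R] /\
  (P [set w | (n%:R / 2 <= \sum_e (X e w \in `[0, a])%:R :> R)%R]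
    <= (2 * n%:R * a)%:E)%E.
Proof.
move=> n0 a0.
have mI e : measurable (X e @^-1` `[0, a]).
  by apply: measurable_cost_event; exact: measurable_itv.
have indE e w : (X e w \in `[0, a])%:R = \1_(X e @^-1` `[0, a]) w :> R.
  by rewrite indicE; congr ((nat_of_bool _)%:R); apply/idP/idP; rewrite inE.
have mB : measurable [set w | n%:R / 2 <= \sum_e (X e w \in `[0, a])%:R :> R].
  apply: measurable_le_set; first exact: measurable_cst.
  apply: measurable_sum => e.
  by rewrite (_ : (fun w => _) = \1_(X e @^-1` `[0, a])) //; apply/funext => w.
split=> //.
have half_ge0 : 0 <= n%:R / 2 :> R by rewrite divr_ge0.
have countB w : [set w | n%:R / 2 <= \sum_e (X e w \in `[0, a])%:R :> R] w ->
    n%:R / 2 <= \sum_e \1_(X e @^-1` `[0, a]) w :> R.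
  move=> /= /le_trans; apply; rewrite le_eqVlt; apply/orP; left; apply/eqP.
  by apply: eq_bigr => e _; rewrite indE.
have markov := markov_count P mI mB half_ge0 countB.
have lt0 : 0 < n%:R / 2 :> R by rewrite divr_gt0 // ltr0n.
rewrite -(@lee_pmul2l _ (n%:R / 2)%:E) ?lte_fin //.
apply: le_trans markov _; rewrite -EFinM.
apply: (@le_trans _ _ (\sum_(e : edge n) a%:E)%E).
  apply: lee_sum => e _; rewrite (prob_cost_le model) // lee_fin.
  by have := expR_ge1Dx (- a); lra.
rewrite sumEFin sumr_const card_prod card_ord lee_fin -(mulr_natl a) natrM.
by rewrite [leRHS](_ : _ = n%:R * n%:R * a) //; lra.
Qed.

(** The hypotheses of good_outcome can fail in six ways: a negative cost, too
    many tiny costs, the three conditions on the graph of cheap edges, and too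
    many cycles. *)
Lemma prob_close_ge (a theta eps : R) (s : nat)
    (q := 1 - (1 - expR (- theta)) / 2) :
  (1 < n)%N -> 0 < a -> 0 < theta -> 0 <= eps -> (0 < s)%N ->
  (forall k, (2 ^ k < n.+1 ^ 2)%N ->
    (12 * k)%:R * theta <= eps * (a * (n%:R / 2))) ->
  ((1 - (2 * n%:R * a + 'C(n, s)%:R * 'C(n, s)%:R * q ^+ (s * s) +
     2 * ('C(n, 1)%:R * 'C(n, n - 7 * s)%:R * q ^+ (n - 7 * s)) + n.+1%:R^-1))%:E
   <= P (close_event alpha X col eps))%E.
Proof.
move=> n1 a0 th0 eps0 s0 small.
have mE := measurable_close_event alpha X col eps.
set F := close_event _ _ _ _ in mE *.
have [mB1 PB1] := prob_some_neg; set B1 := [set w | _] in mB1 PB1.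
have [mB2 PB2] := prob_many_tiny (ltnW n1) a0; set B2 := [set w | _] in mB2 PB2.
have [B3 [mB3 J3 PB3]] := prob_not_joined model s s th0.
have [B4 [mB4 J4 PB4]] := prob_not_joined model 1 (n - 7 * s) th0.
have [B5 [mB5 J5 PB5]] := prob_not_joined model (n - 7 * s) 1 th0.
have [mB6 PB6] := prob_tangled alpha model; set B6 := [set w | _] in mB6 PB6.
rewrite -/q in PB3 PB4 PB5.
have sub : ~` F `<=` B1 `|` (B2 `|` (B3 `|` (B4 `|` (B5 `|` B6)))).
  move=> w nF; apply: contrapT => good; apply: nF.
  have [g1 [g2 [g3 [g4 [g5 g6]]]]] :
      ~ B1 w /\ ~ B2 w /\ ~ B3 w /\ ~ B4 w /\ ~ B5 w /\ ~ B6 w.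
    by do ![split]; move=> ?; apply: good; rewrite /setU /=; tauto.
  apply: (@good_outcome R n alpha (X ^~ w) (col ^~ w) alpha_ge0 n1 theta s
    _ _ a) => //.
  - by move=> e; rewrite leNgt; apply/negP => neg; apply: g1; exists e.
  - split=> //; first exact: J3.
    + move=> u; apply/ltnW/(joined_outdeg (G := cheap X col theta w)).
      by rewrite card_ord; exact: J4.
    + move=> u; apply/ltnW/(joined_indeg (G := cheap X col theta w)).
      by rewrite card_ord; exact: J5.
  - by apply/ltW; rewrite ltNge; apply/negP.
have mU : measurable (B1 `|` (B2 `|` (B3 `|` (B4 `|` (B5 `|` B6))))).
  by do !apply: measurableU => //.
have : (P (~` F) <= P B1 + (P B2 + (P B3 + (P B4 + (P B5 + P B6)))))%E.
  apply: (le_trans (le_measure P _ _ sub)); rewrite ?inE //.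
    exact: measurableC.
  do 4!(apply: le_trans (measureU2 _ _ _) _ => //;
    [by do !apply: measurableU => //|apply: leeD => //]).
  exact: measureU2.
rewrite probability_setC // PB1 add0e.
move=> /le_trans /(_ (leeD PB2 (leeD PB3 (leeD PB4 (leeD PB5 PB6))))).
rewrite -!EFinD -(fineK (fin_num_measure P _ mE)) -EFinB !lee_fin.
rewrite [((n - _) * 1)%N]muln1 !mul1n [_ * 'C(n, 1)%:R]mulrC.
move: (2 * _ * a) (_ * q ^+ (s * s)) (_ * q ^+ (n - _)) (_^-1) (fine _).
by move=> *; lra.
Qed.

End GoodProbability.

(** * Choice of the parameters *)

Lemma bin_le_pow2 n k : ('C(n, k) <= 2 ^ n)%N.
Proof.
rewrite -{1}(card_ord n) -card_draws; apply: leq_trans (max_card _) _.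
by rewrite -cardsT -powersetT card_powerset cardsT card_ord.
Qed.

Lemma bin_le_expn n k : ('C(n, k) <= n ^ k)%N.
Proof.
apply: leq_trans (_ : 'C(n, k) * k`! <= _)%N; first by rewrite leq_pmulr ?fact_gt0.
rewrite bin_ffact; elim: k => [|k IH]; first by rewrite ffactn0.
by rewrite ffactnSr expnSr leq_mul // leq_subr.
Qed.

(** With k = L / 14 one has L <= 2 ^ 4 * 2 ^ k, and 6 + 13 * (4 + k) <= 14 * k
    once k >= 58; the threshold is 14 * 58 = 812. *)
Lemma log_poly_le L : (812 <= L)%N -> (48 * L ^ 13 <= 2 ^ L)%N.
Proof.
move=> L0; pose k := (L %/ 14)%N.
have k58 : (58 <= k)%N by rewrite /k leq_divRL.
have Llt : (L <= 2 ^ 4 * 2 ^ k)%N.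
  have : (L < k.+1 * 14)%N by rewrite /k ltn_ceil.
  have := ltn_expl k (isT : (1 < 2)%N); set K := (2 ^ k)%N => kK Lk.
  rewrite (_ : (2 ^ 4)%N = 16%N) //; clearbody K k; lia.
have le : (2 ^ 6 * (2 ^ 4 * 2 ^ k) ^ 13 <= 2 ^ L)%N.
  rewrite -expnD -expnM -expnD leq_exp2l //.
  have : (k * 14 <= L)%N by rewrite /k leq_trunc_div.
  by clearbody k; lia.
apply: leq_trans le; apply: leq_mul; last by rewrite leq_exp2r.
by rewrite (_ : (2 ^ 6)%N = 64%N).
Qed.

Section Numerics.
Variables (R : realType) (n L : nat).
Hypothesis L_big : (256 <= L)%N.
Hypothesis n_lo : (48 * L ^ 13 <= n)%N.

Let theta : R := (L%:R ^+ 3)^-1.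
Let s := (n %/ L ^ 5)%N.
Let q : R := 1 - (1 - expR (- theta)) / 2.

Let L_gt0 : (0 < L)%N. Proof. exact: leq_trans L_big. Qed.
Let LR_gt0 : 0 < L%:R :> R. Proof. by rewrite ltr0n. Qed.
Let theta_gt0 : 0 < theta. Proof. by rewrite invr_gt0 exprn_gt0. Qed.

Lemma L_le_n : (L <= n)%N.
Proof.
apply: leq_trans n_lo; rewrite -[13%N]/(1 + 12)%N expnD expn1 mulnCA.
by rewrite leq_pmulr // muln_gt0 expn_gt0 L_gt0.
Qed.

Lemma block_gt0 : (0 < s)%N.
Proof.
rewrite divn_gt0 ?expn_gt0 ?L_gt0 //; apply: leq_trans n_lo.
by rewrite -[13%N]/(5 + 8)%N expnD mulnCA leq_pmulr // muln_gt0 expn_gt0 L_gt0.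
Qed.

Lemma block_le : (s * L ^ 5 <= n)%N. Proof. exact: leq_trunc_div. Qed.

Lemma miss_ge0 : 0 <= q.
Proof. by have := expR_gt0 (- theta); rewrite /q; lra. Qed.

(** An edge is cheap and blue with probability at least theta / 4. *)
Lemma miss_pow_le k : q ^+ k <= expR (- (theta * k%:R / 4)).
Proof.
have theta1 : theta <= 1.
  by rewrite invf_le1 ?exprn_gt0 // exprn_ege1 // ler1n.
have e1 := expR_ge1Dx theta; have th0 := theta_gt0.
have e0 : 0 < expR (- theta) := expR_gt0 _.
have ee : expR (- theta) * expR theta = 1 by rewrite -expRD addNr expR0.
have em : expR (- theta) * (1 + theta) <= 1.
  by rewrite -[leRHS]ee ler_wpM2l // ltW.
have ple : expR (- theta) <= 1 - theta / 2 by nra.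
have qle : q <= expR (- (theta / 4)).
  by apply: le_trans (expR_ge1Dx _); rewrite /q; lra.
apply: (@le_trans _ _ (expR (- (theta / 4)) ^+ k)).
  by rewrite lerXn2r // nnegrE ?miss_ge0 ?expR_ge0.
by rewrite -expRM_natl le_eqVlt; apply/orP; left; apply/eqP; congr expR; ring.
Qed.

Lemma pow2_le_expR k : (2 ^ k)%:R <= expR (k%:R) :> R.
Proof.
rewrite -[k%:R]mulr1 expRM_natl natrX lerXn2r ?nnegrE ?expR_ge0 //.
by have := expR_ge1Dx (1 : R); rewrite -[2]/(1 + 1).
Qed.

Lemma expRN_nat_le k : expR (- k%:R) <= k.+1%:R^-1 :> R.
Proof.
rewrite expRN lef_pV2 ?posrE ?expR_gt0 ?ltr0n //.
by rewrite -natr1 addrC expR_ge1Dx.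
Qed.

(** There are at most 4 ^ n pairs of blocks, and theta * s ^ 2 / 4 >= 3 * n
    because s >= n / (2 * L ^ 5) and n >= 48 * L ^ 13. *)
Lemma block_block_bound :
  'C(n, s)%:R * 'C(n, s)%:R * q ^+ (s * s) <= L%:R^-1.
Proof.
have Ln := L_le_n.
have big : (12 * n * L ^ 3 <= s * s)%N.
  have up : (n <= 2 * s * L ^ 5)%N.
    have := ltn_ceil n (_ : 0 < L ^ 5)%N; rewrite expn_gt0 L_gt0 => /(_ isT).
    rewrite -/s; have := block_gt0; set K := (L ^ 5)%N => s0 nK.
    apply: ltnW; apply: leq_trans nK _; rewrite leq_mul2r; apply/orP; right.
    by lia.
  have nn : (n * n <= (2 * s * L ^ 5) * (2 * s * L ^ 5))%N by rewrite leq_mul.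
  have nn' : (48 * L ^ 13 * n <= n * n)%N by rewrite leq_mul.
  have L10 : (0 < 4 * L ^ 10)%N by rewrite muln_gt0 expn_gt0 L_gt0.
  have E1 : (4 * L ^ 10 * (12 * n * L ^ 3) = 48 * L ^ 13 * n)%N by ring.
  have E2 : (4 * L ^ 10 * (s * s) = 2 * s * L ^ 5 * (2 * s * L ^ 5))%N by ring.
  by rewrite -(leq_pmul2l L10) E1 E2; apply: leq_trans nn.
apply: (@le_trans _ _ (expR (- n%:R))); last first.
  apply: le_trans (expRN_nat_le n) _; rewrite lef_pV2 ?posrE ?ltr0n // ler_nat.
  exact: leqW.
have Cle : 'C(n, s)%:R <= expR n%:R :> R.
  by apply: le_trans (pow2_le_expR n); rewrite ler_nat bin_le_pow2.
apply: (@le_trans _ _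
  (expR n%:R * expR n%:R * expR (- (theta * (s * s)%:R / 4)))).
  apply: ler_pM; rewrite ?mulr_ge0 ?exprn_ge0 ?miss_ge0 //.
  - by apply: ler_pM.
  - exact: miss_pow_le.
rewrite -!expRD ler_expR.
have : 12 * n%:R <= theta * (s * s)%:R.
  rewrite [theta * _]mulrC /theta ler_pdivlMr ?exprn_gt0 //.
  by rewrite -natrX -!natrM ler_nat; exact: big.
by lra.
Qed.

Hypothesis n_hi : (n.+1 <= 2 ^ L.+1)%N.

(** The complement of the large block has 7 * s elements, so there are at most
    n ^ (7 * s + 1) choices, whose logarithm is of order n / L ^ 4, against an
    exponent of order theta * n. *)
Lemma vertex_block_bound :
  'C(n, 1)%:R * 'C(n, n - 7 * s)%:R * q ^+ (n - 7 * s) <= L%:R^-1.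
Proof.
have up : (n <= 2 ^ L.+1)%N by apply: ltnW.
have sp := block_gt0.
have le75 : (75 * (L ^ 4 * s) <= n)%N.
  apply: leq_trans block_le; have -> : (s * L ^ 5 = L * (L ^ 4 * s))%N by ring.
  by rewrite leq_mul2r (leq_trans _ L_big) ?orbT.
have sLs : (s <= L ^ 4 * s)%N by rewrite leq_pmull // expn_gt0 L_gt0.
have s7 : (7 * s <= n)%N by lia.
have big : (4 * L ^ 3 * (L.+1 * (7 * s).+1 + L) <= n - 7 * s)%N.
  have le17 : (L.+1 * (7 * s).+1 + L <= 17 * (L * s))%N.
    by have := L_gt0; nia.
  apply: (@leq_trans (4 * L ^ 3 * (17 * (L * s)))).
    by rewrite leq_mul2l le17 orbT.
  have -> : (4 * L ^ 3 * (17 * (L * s)) = 68 * (L ^ 4 * s))%N by ring.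
  by lia.
apply: (@le_trans _ _ (expR (- L%:R))); last first.
  apply: le_trans (expRN_nat_le L) _; rewrite lef_pV2 ?posrE ?ltr0n // ler_nat.
  exact: leqnSn.
apply: (@le_trans _ _ (expR (L.+1 * (7 * s).+1)%:R *
  expR (- (theta * (n - 7 * s)%:R / 4)))).
  apply: ler_pM.
  - by rewrite mulr_ge0.
  - by rewrite exprn_ge0 // miss_ge0.
  - apply: le_trans (pow2_le_expR _); rewrite -natrM ler_nat bin1 bin_sub //.
    rewrite expnM expnS; apply: leq_mul => //.
    apply: leq_trans (bin_le_expn _ _) _.
    by rewrite leq_exp2r // muln_gt0 block_gt0.
  - exact: miss_pow_le.
rewrite -expRD ler_expR.
have : 4 * (L.+1 * (7 * s).+1 + L)%:R <= theta * (n - 7 * s)%:R.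
  rewrite [theta * _]mulrC /theta ler_pdivlMr ?exprn_gt0 //.
  by rewrite -natrX -!natrM ler_nat; apply: leq_trans big; lia.
by rewrite natrD; lra.
Qed.

End Numerics.

(** * Convergence *)

(** The case a = 1 / (L * n), theta = 1 / L ^ 3, s = n / L ^ 5 of
    prob_close_ge: the added edges cost at most 12 * 3 * L / L ^ 3, which is at
    most eps / (2 * L). *)
Lemma prob_close_ge_log (R : realType) (alpha eps : R) (n L : nat)
    d (T : measurableType d) (P : probability T R)
    (X : edge n -> {RV P >-> R}) (col : edge n -> {RV P >-> bool}) :
  random_costs_colours X col -> 0 <= alpha -> 0 < eps ->
  (256 <= L)%N -> (48 * L ^ 13 <= n)%N -> (n.+1 <= 2 ^ L.+1)%N ->
  72 <= eps * L%:R ->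
  ((1 - 6 / L%:R)%:E <= P (close_event alpha X col eps))%E.
Proof.
move=> model alpha0 eps0 L_big n_lo n_hi epsL.
have L0 : (0 < L)%N by apply: leq_trans L_big.
have LR : 0 < L%:R :> R by rewrite ltr0n.
have Ln := L_le_n L_big n_lo.
have n1 : (1 < n)%N by apply: leq_trans Ln; apply: leq_trans L_big.
have n0 : 0 < n%:R :> R by rewrite ltr0n ltnW.
have sp := block_gt0 L_big n_lo.
have C1 := block_block_bound R L_big n_lo.
have C2 := vertex_block_bound R L_big n_lo n_hi.
have a0 : 0 < (L%:R * n%:R)^-1 :> R by rewrite invr_gt0 mulr_gt0.
have th0 : 0 < (L%:R ^+ 3)^-1 :> R by rewrite invr_gt0 exprn_gt0.
(* Since n.+1 <= 2 ^ L.+1, there are at most 2 * L + 1 <= 3 * L cycles. *)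
have small k : (2 ^ k < n.+1 ^ 2)%N ->
    (12 * k)%:R * (L%:R ^+ 3)^-1 <= eps * ((L%:R * n%:R)^-1 * (n%:R / 2)).
  move=> lt; have k3 : (k <= 3 * L)%N.
    have : (2 ^ k < 2 ^ (L.+1 * 2))%N.
      by apply: leq_trans lt _; rewrite expnM leq_exp2r.
    by rewrite ltn_exp2l //; lia.
  have -> : eps * ((L%:R * n%:R)^-1 * (n%:R / 2)) =
      (eps * L%:R) * L%:R / 2 / L%:R ^+ 3.
    by field; rewrite !gt_eqF.
  rewrite ler_pM2r //; apply: (@le_trans _ _ (36 * L%:R)).
    by rewrite -natrM ler_nat; lia.
  have : 72 * L%:R <= eps * L%:R * L%:R by rewrite ler_wpM2r // ltW.
  by lra.
apply: (le_trans _ (prob_close_ge model alpha0 n1 a0 th0 (ltW eps0) sp small)).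
rewrite lee_fin.
have nL : n.+1%:R^-1 <= L%:R^-1 :> R.
  by rewrite lef_pV2 ?posrE ?ltr0n // ler_nat leqW.
have -> : 2 * n%:R * (L%:R * n%:R)^-1 = 2 * L%:R^-1 :> R.
  by rewrite invfM; field; rewrite ?gt_eqF.
move: C1 C2 nL; set c1 := _ * _ ^+ (_ * _); set c2 := _ * _ ^+ (n - _).
by move: c1 c2 (n.+1%:R^-1) (L%:R^-1) => *; lra.
Qed.

(** Convergence along all n implies convergence along D. *)
Lemma whp_of_lower_bound (R : realType) (d : nat -> measure_display)
    (Omega : forall n, measurableType (d n))
    (P : forall n, probability (Omega n) R) (D : set nat)
    (E : forall n, set (Omega n)) :
  (forall n, measurable (E n)) ->
  (forall del : R, 0 < del ->
    exists N, forall n, (N <= n)%N -> ((1 - del)%:E <= P n (E n))%E) ->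
  whp P D E.
Proof.
move=> mE low; suff cvgE : P n (E n) @[n --> \oo] --> 1%E.
  by apply: cvg_trans cvgE; apply: cvg_app; exact: cvg_within.
have finE n : P n (E n) \is a fin_num by exact: fin_num_measure.
apply/fine_cvgP; split; first by exists 0%N.
apply/cvgrPdist_le => del del0; have [N Nlow] := low _ del0.
exists N => // n /= /Nlow; rewrite -(fineK (finE n)) lee_fin => lown.
have P1 : fine (P n (E n)) <= 1.
  by rewrite -lee_fin fineK //; exact: probability_le1.
by rewrite ger0_norm ?subr_ge0 //; lra.
Qed.

Theorem theorem4 (R : realType) (alpha : R)
    (halpha0 : 0 < alpha) (halpha : alpha < 2^-1)
    (d : nat -> measure_display)
    (Omega : forall n : nat, measurableType (d n))
    (P : forall n : nat, probability (Omega n) R)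
    (X : forall n : nat, edge n -> {RV (P n) >-> R})
    (col : forall n : nat, edge n -> {RV (P n) >-> bool})
    (hmodel : forall n : nat, random_costs_colours (X n) (col n)) :
  sim_whp P [set n : nat | alpha * n%:R \is a Num.int]
    (fun n w => Z_ATSP alpha (fun e => X n e w) (red_edges (col n) w))
    (fun n w => Z_PM alpha (fun e => X n e w) (red_edges (col n) w)).
Proof.
move=> eps eps0; apply: whp_of_lower_bound => [n|del del0].
  exact: measurable_close_event.
pose K := (812 + Num.bound (72 / eps) + Num.bound (6 / del))%N.
exists (2 ^ K)%N => n nK.
have n0 : (0 < n)%N by apply: leq_trans nK; rewrite expn_gt0.
pose L := trunc_log 2 n.
have KL : (K <= L)%N by apply: trunc_log_max.
have L812 : (812 <= L)%N by apply: leq_trans KL; rewrite /K -addnA leq_addr.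
have Lbound (x : R) : 0 <= x -> (Num.bound x <= L)%N -> x <= L%:R.
  move=> x0 le; apply: (le_trans (ltW (archi_boundP x0))).
  by rewrite ler_nat.
have epsL : 72 <= eps * L%:R.
  rewrite mulrC -ler_pdivrMr //; apply: Lbound; first by rewrite divr_ge0 ?ltW.
  by apply: leq_trans KL; rewrite /K addnAC leq_addl.
have delL : 6 <= del * L%:R.
  rewrite mulrC -ler_pdivrMr //; apply: Lbound; first by rewrite divr_ge0 ?ltW.
  by apply: leq_trans KL; rewrite /K leq_addl.
have LR : 0 < L%:R :> R by rewrite ltr0n (leq_trans _ L812).
have n_lo : (48 * L ^ 13 <= n)%N.
  exact: leq_trans (log_poly_le L812) (trunc_logP _ n0).
have n_hi : (n.+1 <= 2 ^ L.+1)%N by exact: trunc_log_ltn.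
have L256 : (256 <= L)%N by exact: leq_trans L812.
have low := prob_close_ge_log (hmodel n) (ltW halpha0) eps0 L256 n_lo n_hi epsL.
apply: le_trans low.
by rewrite lee_fin lerD2l lerN2 ler_pdivrMr.
Qed.
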